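(* Let $x_1,\dots,x_n$, $a_1,\dots,a_n$, and $c_1,\dots,c_{n-2}$ be indeterminates. For each $j=1,\dots,n$, let $P_j$ be an $A_{j-1}$ theta function of norm $(c_1\cdots c_{n-2}a_{j+1}\cdots a_n)^{-1}$. Then, for $n\geq 2$, $$\det_{1\leq i,j\leq n}\left(x_i^{1-n}\prod_{k=1}^{n-2}\theta(c_kx_i)\,P_j(x_i)\prod_{k=j+1}^n\theta(a_kx_i)+x_i^{n-1}\prod_{k=1}^{n-2}\theta(c_kx_i^{-1})\,P_j(x_i^{-1})\prod_{k=j+1}^n\theta(a_kx_i^{-1})\right)$$ $$=-\frac{4\,a_1\cdots a_n\,c_1\cdots c_{n-2}}{\theta(c_1\cdots c_{n-2}a_1\cdots a_n)}\prod_{i=1}^nP_i(1/a_i)\prod_{1\leq i\leq j\leq n-2}\theta(c_ic_j)\prod_{1\le i<j\le n}a_jx_i^{-1}\,\theta(x_ix_j^{\pm}).$$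
   Context: Fix $p\in\mathbb C$ with $0<|p|<1$. Put $(a;p)_\infty=\prod_{j\ge0}(1-ap^j)$, $\theta(x)=\theta(x;p)=(x;p)_\infty(p/x;p)_\infty$ for $x\ne0$, and $\theta(xy^{\pm})=\theta(xy)\theta(x/y)$. A function $f$ holomorphic on $\mathbb C\setminus\{0\}$ is called an $A_{m-1}$ theta function of norm $s$ (with $m\ge1$ and $s\in\mathbb C\setminus\{0\}$) if $f(px)=\frac{(-1)^m}{s x^m}f(x)$ for all $x\neq0$. ''Indeterminates'' are understood as nonzero complex numbers, assumed generic so that no denominators vanish. *)

(* Defs.v *)
From HB Require Import structures.
From mathcomp Require Import all_boot all_order all_algebra.
From mathcomp Require Import complex.
From mathcomp Require Import all_classical all_reals all_analysis.

Set Implicit Arguments.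
Unset Strict Implicit.
Unset Printing Implicit Defensive.

Import Order.TTheory GRing.Theory Num.Theory.
Import numFieldNormedType.Exports.

Local Open Scope classical_set_scope.
Local Open Scope ring_scope.
Local Open Scope complex_scope.

(* The complex numbers.  They are given the type numClosedFieldType, because
   MathComp-Analysis puts the topology and the norm of the modulus on the sort
   of any numClosedFieldType, but not on the bare type R[i]. *)
Definition Cplx (R : realType) : numClosedFieldType := R[i].

Definition qpoch (R : realType) (p a : Cplx R) : Cplx R :=
  lim ((fun N : nat => \prod_(0 <= j < N) (1 - a * p ^+ j)) @ \oo).

Definition theta (R : realType) (p x : Cplx R) : Cplx R :=
  qpoch p x * qpoch p (p / x).

(* theta (x y^{+-}) *)
Definition theta_pm (R : realType) (p x y : Cplx R) : Cplx R :=
  theta p (x * y) * theta p (x / y).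

(* Derivability over the base field Cplx R in the direction 1 is complex
   differentiability.  The value f 0 is irrelevant. *)
Definition holomorphic_punctured (R : realType) (f : Cplx R -> Cplx R) : Prop :=
  forall z : Cplx R, z != 0 -> derivable f z 1.

(* f is an A_{m-1} theta function of norm s; note that the first numerical
   argument is m, not the rank m - 1. *)
Definition A_theta (R : realType) (p : Cplx R) (m : nat) (s : Cplx R)
    (f : Cplx R -> Cplx R) : Prop :=
  [/\ (0 < m)%N, s != 0, holomorphic_punctured f &
      forall x : Cplx R, x != 0 -> f (p * x) = (-1) ^+ m / (s * x ^+ m) * f x].

(* Main.v *)
Require Import Defs.
From HB Require Import structures.
From mathcomp Require Import all_boot all_order all_fingroup all_algebra.
From mathcomp Require Import complex.
From mathcomp Require Import all_classical all_reals all_analysis.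
From mathcomp Require Import ring lra zify.

(** The determinant has rows of the form G_j(x_i) + G_j(1/x_i), where
    G_j(x) = phi(x) F_j(x) with phi(x) = x^(1-n) prod_k theta(c_k x) and
    F_j(x) = P_j(x) prod_(k>j) theta(a_k x).  Expanding every row as a sum over
    x_i and 1/x_i gives a sum, over all sign changes of the variables, of
    determinants det (F_j(y_i)) times row factors.

    All F_j are theta functions of degree n with the same norm
    1 / (c_1 ... c_(n-2)).  Such functions form a space of dimension at most n, and
    det (F_j(y_i)) is evaluated by induction: as a function of one variable both
    sides lie in this space, both vanish when two variables agree, and at
    y_n = 1/a_n only the last entry of the last row survives
    ([det_thetaA]).  What is left is a sum over sign changes of explicit products
    of theta functions.  In each variable it lies in the n-dimensional space of
    type D, it vanishes when x_i = x_j or x_i = 1/x_j modulo powers of p, and at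
    x_n = c_(n-2) it reduces to the same sum with n - 1 variables
    ([signsum_eval]).  For n = 2 its four terms are equal, which gives the factor 4.

    In both inductions, values of the variables in special position are reached
    by interpolation from generic ones ([vanish_by_interpolation]).

    The dimension bounds come from Laurent coefficients.  If
    f(p x) = K x^(-m) f(x), then the coefficients of f satisfy a recursion of step m,
    so m consecutive ones determine f.  Here the
    coefficients are defined as limits of means over 2^N-th roots of unity.  The
    means converge, and their limit is independent of the radius, by a discrete
    form of Goursat's theorem ([goursat]); a function whose coefficients
    all vanish is zero, by testing against a polynomial peak ([laurent_unique]).
    A function with Lagrange interpolation data can then be recovered from its values
    at the nodes ([unisolvent]).  The theta function itself is holomorphic because
    the partial products have uniformly bounded second-order remainders
    ([qpart_taylor]). *)

Set Implicit Arguments.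
Unset Strict Implicit.
Unset Printing Implicit Defensive.

Import Order.TTheory GRing.Theory Num.Theory.
Import numFieldNormedType.Exports.
Import ComplexField.Normc ComplexField.

Local Open Scope ring_scope.
Local Open Scope complex_scope.

Local Notation holo := holomorphic_punctured.

(** * The real-valued modulus *)

Section Modulus.
Variable R : realType.
Local Notation C := (Cplx R).

(** The library norm of a complex number is itself complex; estimates are made
    with this real-valued copy because [lra] and [nra] need a real field. *)
Definition modulus (z : C) : R := normc (z : R[i]).

Definition ofR (r : R) : C := (r%:C : R[i]).

Lemma modulusE (z : C) : `|z| = ofR (modulus z).
Proof. by []. Qed.

Lemma ofR_lt (r s : R) : (ofR r < ofR s) = (r < s).
Proof. exact: ltcR. Qed.

Lemma ofR_le (r s : R) : (ofR r <= ofR s) = (r <= s).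
Proof. exact: lecR. Qed.

Lemma ofR_gt0 (r : R) : (0 < ofR r) = (0 < r).
Proof. exact: (ofR_lt 0 r). Qed.

Lemma gt0_ofR (e : C) : 0 < e -> e = ofR (complex.Re e) /\ 0 < complex.Re e.
Proof.
case: e => a b; rewrite ltcE /= => /andP[/eqP -> ha]; split => //.
Qed.

Lemma ofR_mod (r : R) : 0 <= r -> modulus (ofR r) = r.
Proof. 
by move=> h; rewrite /modulus /ofR /= expr0n addr0 sqrtr_sqr ger0_norm.
Qed.

Lemma modulusM (x y : C) : modulus (x * y) = modulus x * modulus y.
Proof. exact: normcM. Qed.

Lemma modulusV (x : C) : modulus x^-1 = (modulus x)^-1.
Proof. exact: normcV. Qed.

Lemma modulusN (x : C) : modulus (- x) = modulus x.
Proof. exact: normcN. Qed.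

Lemma modulus1 : modulus 1 = 1.
Proof. exact: normc1. Qed.

Lemma modulus0 : modulus 0 = 0.
Proof. exact: normc0. Qed.

Lemma modulusX (x : C) n : modulus (x ^+ n) = modulus x ^+ n.
Proof. by elim: n => [|n IH]; rewrite ?expr0 ?modulus1 // !exprS modulusM IH. Qed.

Lemma modulusB (x y : C) : modulus (x - y) = modulus (y - x).
Proof. by rewrite -opprB modulusN. Qed.

Lemma modulus_ge0 (x : C) : 0 <= modulus x.
Proof. by rewrite -ofR_le -modulusE normr_ge0. Qed.

Lemma modulus_gt0 (x : C) : (0 < modulus x) = (x != 0).
Proof. by rewrite -ofR_gt0 -modulusE normr_gt0. Qed.

Lemma modulusD (x y : C) : modulus (x + y) <= modulus x + modulus y.
Proof. exact: le_normcD. Qed.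

Lemma modulus_sum (I : Type) (r : seq I) (P : pred I) (F : I -> C) :
  modulus (\sum_(i <- r | P i) F i) <= \sum_(i <- r | P i) modulus (F i).
Proof.
elim/big_ind2: _ => [|x1 x2 y1 y2 h1 h2|//]; first by rewrite modulus0.
by apply: le_trans (modulusD _ _) _; apply: lerD.
Qed.

Lemma modulus_nat n : modulus n%:R = n%:R.
Proof. by have := ofR_mod (ler0n R n); rewrite /ofR rmorph_nat. Qed.

Lemma Re_le (z : C) : `|complex.Re (z : R[i])| <= modulus z.
Proof.
case: z => a b; rewrite /modulus /= -sqrtr_sqr ler_wsqrtr // lerDl sqr_ge0 //.
Qed.

Lemma Im_le (z : C) : `|complex.Im (z : R[i])| <= modulus z.
Proof.
case: z => a b; rewrite /modulus /= -sqrtr_sqr ler_wsqrtr // lerDr sqr_ge0 //.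
Qed.

Lemma modulus_le (z : C) : modulus z <= `|complex.Re (z : R[i])| + `|complex.Im (z : R[i])|.
Proof.
case: z => a b; rewrite /modulus /=.
rewrite -[leRHS]ger0_norm ?addr_ge0 // -sqrtr_sqr ler_wsqrtr //.
rewrite -(real_normK (num_real a)) -(real_normK (num_real b)).
by rewrite sqrrD addrAC lerDl mulrn_wge0 ?mulr_ge0.
Qed.

End Modulus.

Arguments modulus : simpl never.

(** * Limits of complex sequences *)

Section Limits.
Variable R : realType.
Local Notation C := (Cplx R).
Implicit Types (u v : nat -> C) (l : C).

Definition tends u l := forall e : R, 0 < e ->
  exists N, forall n, (N <= n)%N -> modulus (u n - l) < e.

Lemma tends_cvg u l : tends u l -> (u @ \oo --> l)%classic.
Proof.
move=> h; apply/cvgrPdist_lt => e e0.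
have [-> r0] := gt0_ofR e0.
have [N hN] := h _ r0.
exists N => // n /= /hN; rewrite modulusE ofR_lt modulusB; exact.
Qed.

Lemma tends_lim u l : tends u l -> (lim (u @ \oo) = l)%classic.
Proof. by move=> /tends_cvg h; apply: cvg_lim. Qed.

Lemma tends_unique u l l' : tends u l -> tends u l' -> l = l'.
Proof. by move=> /tends_lim <- /tends_lim. Qed.

Lemma tends_ext u v l : u =1 v -> tends u l -> tends v l.
Proof. by move=> h hu e /hu[N hN]; exists N => n /hN; rewrite h. Qed.

Lemma tends_cst l : tends (fun=> l) l.
Proof. by move=> e e0; exists 0 => n _; rewrite subrr modulus0. Qed.

Lemma tendsD u v l m : tends u l -> tends v m -> tends (fun n => u n + v n) (l + m).
Proof.
move=> hu hv e e0; have e2 : 0 < e / 2 by rewrite divr_gt0.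
have [N hN] := hu _ e2; have [M hM] := hv _ e2.
exists (maxn N M) => n; rewrite geq_max => /andP[/hN h1 /hM h2].
rewrite opprD addrACA (le_lt_trans (modulusD _ _)) //.
by rewrite [e]splitr ltrD.
Qed.

Lemma tendsZ u l (c : C) : tends u l -> tends (fun n => c * u n) (c * l).
Proof.
move=> hu e e0; have c0 : 0 < modulus c + 1 by rewrite ltr_wpDl ?modulus_ge0.
have [N hN] := hu _ (divr_gt0 e0 c0); exists N => n /hN h.
rewrite -mulrBr modulusM.
apply: (@le_lt_trans _ _ ((modulus c + 1) * modulus (u n - l))).
  by rewrite ler_wpM2r ?modulus_ge0 // lerDl.
by rewrite mulrC -ltr_pdivlMr.
Qed.

Lemma tends_sum (I : Type) (r : seq I) (F : I -> nat -> C) (L : I -> C) :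
  (forall i, tends (F i) (L i)) ->
  tends (fun n => \sum_(i <- r) F i n) (\sum_(i <- r) L i).
Proof.
move=> h; elim: r => [|i r IH].
  by rewrite big_nil; apply: tends_ext (tends_cst 0) => n; rewrite big_nil.
rewrite big_cons; apply: tends_ext (tendsD (h i) IH) => n.
by rewrite big_cons.
Qed.

Lemma tendsS u l : tends u l -> tends (fun n => u n.+1) l.
Proof. by move=> h e /h[N hN]; exists N => n hn; apply: hN; apply: leqW. Qed.

Lemma tends_near u v l : tends u l -> tends (fun n => v n - u n) 0 -> tends v l.
Proof.
move=> hu hv; rewrite -[l]addr0; apply: tends_ext (tendsD hu hv) => n.
by rewrite addrC subrK.
Qed.

Definition is_cauchy u := forall e : R, 0 < e ->
  exists N, forall n, (N <= n)%N -> modulus (u n - u N) <= e.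

Lemma cauchy_real (u : nat -> R) : (forall e : R, 0 < e ->
  exists N, forall n, (N <= n)%N -> `|u n - u N| <= e) ->
  exists m : R, forall e : R, 0 < e ->
    exists N, forall n, (N <= n)%N -> `|u n - m| < e.
Proof.
move=> h.
have : (cvg (u @ \oo))%classic.
  apply/cauchy_cvgP/cauchy_exP => e e0.
  have [N hN] := h _ (divr_gt0 e0 (ltr0Sn R 1)).
  exists (u N); exists N => // n /= /hN; rewrite /ball /= distrC => h'.
  by apply: (le_lt_trans h'); rewrite ltr_pdivrMr // ltr_pMr // ltr1n.
move=> /cvgrPdist_lt hl; exists (lim (u @ \oo)%classic) => e /hl[N _ hN].
by exists N => n /hN; rewrite distrC.
Qed.

Lemma is_cauchy_tends u : is_cauchy u -> exists l, tends u l.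
Proof.
move=> h.
have [|a ha] := @cauchy_real (fun n => complex.Re (u n : R[i])).
  move=> e /h[N hN]; exists N => n /hN; apply: le_trans.
  by apply: le_trans (Re_le _); case: (u n) => ? ?; case: (u N).
have [|b hb] := @cauchy_real (fun n => complex.Im (u n : R[i])).
  move=> e /h[N hN]; exists N => n /hN; apply: le_trans.
  by apply: le_trans (Im_le _); case: (u n) => ? ?; case: (u N).
exists (a +i* b : R[i]) => e e0; have e2 : 0 < e / 2 by rewrite divr_gt0.
have [N hN] := ha _ e2; have [M hM] := hb _ e2.
exists (maxn N M) => n; rewrite geq_max => /andP[/hN h1 /hM h2].
apply: le_lt_trans (modulus_le _) _; rewrite [e]splitr.
by move: h1 h2; case: (u n) => c d /= h1 h2; apply: ltrD.
Qed.

End Limits.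

(** * Complex differentiability *)

Section Derivative.
Variable R : realType.
Local Notation C := (Cplx R).

Definition has_deriv (f : C -> C) (z d : C) := forall e : R, 0 < e ->
  exists2 r : R, 0 < r & forall h, modulus h < r ->
    modulus (f (z + h) - f z - d * h) <= e * modulus h.

Lemma derivable_has (f : C -> C) z : derivable f z 1 -> exists d, has_deriv f z d.
Proof.
move=> /cvgrPdist_le; set d := (X in forall e, 0 < e -> \forall t \near _, `|X - _| <= e).
move=> H; exists d => e e0.
have [r /= r0 hr] := H (ofR e) (eq_ind_r is_true e0 (ofR_gt0 e)).
have [re rr0] := gt0_ofR r0.
exists (complex.Re r) => // h hh.
have [->|h0] := eqVneq h 0; first by rewrite addr0 subrr mulr0 subrr modulus0 mulr0.
have := hr h; rewrite /ball_ /= sub0r normrN modulusE re ofR_lt => /(_ hh h0).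
rewrite modulusE ofR_le => h1.
have -> : f (z + h) - f z - d * h = - ((d - h^-1 *: (f (h *: 1 + z) - f z)) * h).
  rewrite mulrBl -[h *: 1]/(h * 1) mulr1 (addrC h).
  have -> : h^-1 *: (f (z + h) - f z) * h = f (z + h) - f z.
    by rewrite -[h^-1 *: _]/(h^-1 * _) mulrAC mulVf ?mul1r.
  by rewrite opprB.
by rewrite modulusN modulusM ler_wpM2r ?modulus_ge0.
Qed.

Lemma has_derivable (f : C -> C) z d : has_deriv f z d -> derivable f z 1.
Proof.
move=> H; apply/cvg_ex; exists d; apply/cvgrPdist_le => e e0.
have [-> r0] := gt0_ofR e0.
have [r rp hr] := H _ r0.
exists (ofR r); rewrite /= ?ofR_gt0 // => h; rewrite /ball_ /= sub0r normrN modulusE ofR_lt => hh h0.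
rewrite modulusE ofR_le -[h *: 1]/(h * 1) mulr1 (addrC h).
have -> : d - h^-1 *: (f (z + h) - f z) = - ((f (z + h) - f z - d * h) * h^-1).
  by rewrite mulrBl mulfK // opprB [X in _ - X]mulrC.
rewrite modulusN modulusM modulusV ler_pdivrMr ?modulus_gt0 //.
exact: hr.
Qed.

Lemma has_deriv_cont f z d : has_deriv f z d -> forall e : R, 0 < e ->
  exists2 r : R, 0 < r & forall h, modulus h < r -> modulus (f (z + h) - f z) <= e.
Proof.
move=> H e e0; have [r r0 hr] := H 1 ltr01.
have k0 : 0 < 1 + modulus d by rewrite ltr_wpDr ?modulus_ge0.
exists (Num.min r (e / (1 + modulus d))); first by rewrite lt_min r0 divr_gt0.
move=> h; rewrite lt_min => /andP[/hr h1 h2].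
rewrite -[_ - f z](subrK (d * h)) (le_trans (modulusD _ _)) //.
rewrite modulusM; move: h2; rewrite ltr_pdivlMr //.
by rewrite mul1r in h1; have := modulus_ge0 h; have := modulus_ge0 d; nra.
Qed.

End Derivative.

(** * Bisection of parallelograms *)

Section Bisection.
Variable R : realType.
Local Notation C := (Cplx R).

Lemma small_pow2 (L d : R) : 0 < d -> exists K, forall k, (K <= k)%N -> L / 2 ^+ k < d.
Proof.
move=> d0; pose n := archimedean.Num.bound (`|L| / d).
exists n => k hk.
rewrite ltr_pdivrMr ?exprn_gt0 // (le_lt_trans (ler_norm _)) // mulrC -ltr_pdivrMr //.
have h := @archimedean.Num.Theory.archi_boundP R (`|L| / d) (divr_ge0 (normr_ge0 _) (ltW d0)).
rewrite (lt_le_trans h) // -natrX ler_nat.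
by apply: leq_trans hk _; apply/ltnW/ltn_expl.
Qed.

Lemma tends_mod_le (u : nat -> C) (l c : C) (b : R) (N : nat) :
  (forall n, (N <= n)%N -> modulus (u n - c) <= b) -> tends u l -> modulus (l - c) <= b.
Proof.
move=> hb hl; apply/ler_addgt0Pr => e e0.
have [M hM] := hl _ e0.
have h1 := hM (maxn N M) (leq_maxr _ _); have h2 := hb (maxn N M) (leq_maxl _ _).
have -> : l - c = (u (maxn N M) - c) - (u (maxn N M) - l) by ring.
by rewrite (le_trans (modulusD _ _)) // modulusN lerD // ltW.
Qed.

(** The subdivision argument behind Goursat's theorem.  If a cell fails then one
    of its quarters fails, so failing cells shrink to a point t, where the local
    hypothesis is violated.  [B k z] speaks of the cell with corner z and sides
    u / 2^k and v / 2^k; with v = 0 the lemma bisects a segment. *)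
Lemma bisection (u v : C) (B : nat -> C -> Prop) :
  (forall k z, B k.+1 z -> B k.+1 (z + u / 2 ^+ k.+1) -> B k.+1 (z + v / 2 ^+ k.+1) ->
     B k.+1 (z + u / 2 ^+ k.+1 + v / 2 ^+ k.+1) -> B k z) ->
  (forall t, exists2 d : R, 0 < d & forall k z,
     modulus (z - t) <= (modulus u + modulus v) / 2 ^+ k ->
     (modulus u + modulus v) / 2 ^+ k < d -> B k z) ->
  forall z, B 0%N z.
Proof.
set L := modulus u + modulus v => split_ local z0; apply: contrapT => nB0.
have step k z : { z' | ~ B k z -> ~ B k.+1 z' /\ modulus (z' - z) <= L / 2 ^+ k.+1 }.
  apply: cid; have [h|nB] := pselect (B k z); first by exists z.
  have m2 (a : C) : modulus (a / 2 ^+ k.+1) = modulus a / 2 ^+ k.+1.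
    by rewrite modulusM modulusV modulusX modulus_nat.
  have L0 : 0 <= L / 2 ^+ k.+1 by rewrite divr_ge0 ?addr_ge0 ?modulus_ge0 ?exprn_ge0.
  have p2 : 0 < 2 ^+ k.+1 :> R by rewrite exprn_gt0.
  have [h1|h1] := pselect (B k.+1 z); last first.
    by exists z => _; split=> //; rewrite subrr modulus0.
  have [h2|h2] := pselect (B k.+1 (z + u / 2 ^+ k.+1)); last first.
    exists (z + u / 2 ^+ k.+1) => _; split=> //.
    by rewrite addrC addKr m2 ler_pM2r ?invr_gt0 // lerDl modulus_ge0.
  have [h3|h3] := pselect (B k.+1 (z + v / 2 ^+ k.+1)); last first.
    exists (z + v / 2 ^+ k.+1) => _; split=> //.
    by rewrite addrC addKr m2 ler_pM2r ?invr_gt0 // lerDr modulus_ge0.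
  exists (z + u / 2 ^+ k.+1 + v / 2 ^+ k.+1) => _; split.
    by move=> h4; apply: nB; apply: split_.
  rewrite addrAC (addrAC z) subrr add0r (le_trans (modulusD _ _)) // !m2 -mulrDl //.
(* a nested sequence of failing cells *)
pose s := fix s n := if n is k.+1 then sval (step k (s k)) else z0.
have nBs k : ~ B k (s k).
  by elim: k => [//|k IH] /=; case: (svalP (step k (s k)) IH).
have ds k : modulus (s k.+1 - s k) <= L / 2 ^+ k.+1.
  by case: (svalP (step k (s k)) (nBs k)).
have L0 : 0 <= L by rewrite addr_ge0 ?modulus_ge0.
have dist k j : modulus (s (k + j)%N - s k) <= L / 2 ^+ k - L / 2 ^+ (k + j).
  elim: j => [|j IH]; first by rewrite addn0 !subrr modulus0.
  rewrite addnS; have -> : s (k + j).+1 - s k = (s (k + j).+1 - s (k + j)%N) + (s (k + j)%N - s k) by ring.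
  apply: (le_trans (modulusD _ _)); apply: (le_trans (lerD (ds _) IH)).
  rewrite exprS invfM; move: (2 ^+ (k + j))^-1 (L / 2 ^+ k) => q a; lra.
have dist' k n : (k <= n)%N -> modulus (s n - s k) <= L / 2 ^+ k.
  move=> /subnKC <-; apply: le_trans (dist _ _) _.
  by rewrite gerBl divr_ge0 // exprn_ge0.
have [t ht] : exists t, tends s t.
  apply: is_cauchy_tends => e e0; have [K hK] := small_pow2 L e0.
  by exists K => n /dist' /le_trans; apply; apply: ltW; apply: hK.
have [d d0 hd] := local t.
have [K hK] := small_pow2 L d0.
apply: (nBs K); apply: hd; last exact: hK.
by rewrite modulusB; apply: tends_mod_le ht; apply: dist'.
Qed.

End Bisection.

(** * Dyadic Riemann sums and Goursat's theorem *)

Section Riemann.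
Variable R : realType.
Local Notation C := (Cplx R).
Implicit Types (g : C -> C) (z u v : C).

Definition rsum N g z u : C := u / 2 ^+ N * \sum_(j < 2 ^ N) g (z + u * j%:R / 2 ^+ N).

(** Left-endpoint sums of order N + 1 are exactly additive at the midpoint; this is
    why dyadic sums can replace integrals below, with no error to control. *)
Lemma rsum_split N g z u :
  rsum N.+1 g z u = rsum N g z (u / 2) + rsum N g (z + u / 2) (u / 2).
Proof.
have q0 : (2 ^+ N : C) != 0 by rewrite expf_neq0.
have t0 : (2 : C) != 0 by [].
rewrite /rsum expnS mul2n -addnn big_split_ord /= exprS.
have -> : u / (2 * 2 ^+ N) = u / 2 / 2 ^+ N by field.
rewrite mulrDr; congr (_ * _ + _ * _); apply: eq_bigr => j _; congr (g _).
  by field.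
by rewrite natrD natrX; field.
Qed.

Lemma rsum_bound N g z u (M : R) :
  (forall j, (j < 2 ^ N)%N -> modulus (g (z + u * j%:R / 2 ^+ N)) <= M) ->
  modulus (rsum N g z u) <= modulus u * M.
Proof.
move=> h; have q0 : 0 < 2 ^+ N :> R by rewrite exprn_gt0.
rewrite modulusM modulusM modulusV modulusX modulus_nat -mulrA ler_wpM2l ?modulus_ge0 //.
rewrite mulrC ler_pdivrMr // (le_trans (modulus_sum _ _ _)) //.
apply: (@le_trans _ _ (\sum_(j < 2 ^ N) M)); first by apply: ler_sum => j _; apply: h.
by rewrite sumr_const card_ord -natrX mulr_natr.
Qed.

Lemma rsumB N g1 g2 z u :
  rsum N (fun w => g1 w - g2 w) z u = rsum N g1 z u - rsum N g2 z u.
Proof. by rewrite /rsum sumrB mulrBr. Qed.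

Lemma rsum_cst N c z u : rsum N (fun=> c) z u = u * c.
Proof.
have q0 : (2 ^+ N : C) != 0 by rewrite expf_neq0.
by rewrite /rsum sumr_const card_ord -[c *+ _]mulr_natr natrX; field.
Qed.

Lemma rsum_point N u (j : nat) : (j < 2 ^ N)%N ->
  modulus (u * j%:R / 2 ^+ N) <= modulus u.
Proof.
move=> hj; rewrite !modulusM modulusV modulusX !modulus_nat ler_pdivrMr ?exprn_gt0 //.
by rewrite ler_wpM2l ?modulus_ge0 // -natrX ler_nat ltnW.
Qed.

(** Discrete contour integral around the parallelogram with corner z and sides u, v.
    Opposite sides are traversed in the same direction and subtracted, so that
    sides shared by two cells cancel exactly. *)
Definition boundary N g z u v : C :=
  rsum N g z u + rsum N g (z + u) v - rsum N g (z + v) u - rsum N g z v.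

Lemma boundary_split N g z u v :
  boundary N.+1 g z u v =
    boundary N g z (u / 2) (v / 2) + boundary N g (z + u / 2) (u / 2) (v / 2)
  + boundary N g (z + v / 2) (u / 2) (v / 2)
  + boundary N g (z + u / 2 + v / 2) (u / 2) (v / 2).
Proof.
rewrite /boundary !rsum_split.
have -> : z + u / 2 + v / 2 + u / 2 = z + u + v / 2 by field.
have -> : z + u / 2 + u / 2 = z + u by field.
have -> : z + v / 2 + v / 2 = z + v by field.
have -> : z + u / 2 + v / 2 + v / 2 = z + v + u / 2 by field.
have -> : z + v / 2 + u / 2 = z + u / 2 + v / 2 by field.
ring.
Qed.

(** Opposite sides differ by the constant slope times the shift, and the two
    contributions b u v cancel: no limit in N is involved. *)
Lemma boundary_affine N (a b : C) z u v : boundary N (fun w => a + b * w) z u v = 0.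
Proof.
have shift y s t : rsum N (fun w => a + b * w) (y + s) t - rsum N (fun w => a + b * w) y t = t * (b * s).
  rewrite -(rsum_cst N (b * s) y t) /rsum -mulrBr -sumrB; congr (_ * _).
  by apply: eq_bigr => j _; ring.
rewrite /boundary; set f := (fun w => _).
rewrite (_ : _ - _ = (rsum N f (z + u) v - rsum N f z v) - (rsum N f (z + v) u - rsum N f z u)).
  by rewrite !shift; ring.
by ring.
Qed.

Lemma boundaryB N g1 g2 z u v :
  boundary N (fun w => g1 w - g2 w) z u v = boundary N g1 z u v - boundary N g2 z u v.
Proof. by rewrite /boundary !rsumB; ring. Qed.

Lemma boundary_bound N g z u v (M : R) :
  (forall w, modulus (w - z) <= modulus u + modulus v -> modulus (g w) <= M) ->
  modulus (boundary N g z u v) <= 2 * (modulus u + modulus v) * M.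
Proof.
move=> h; have mu := modulus_ge0 u; have mv := modulus_ge0 v.
have b y t : (forall j, (j < 2 ^ N)%N -> modulus (y + t * j%:R / 2 ^+ N - z) <= modulus u + modulus v) ->
    modulus (rsum N g y t) <= modulus t * M.
  by move=> H; apply: rsum_bound => j /H; apply: h.
have e1 : modulus (rsum N g z u) <= modulus u * M.
  by apply: b => j hj; rewrite addrC addKr (le_trans (rsum_point u hj)) // lerDl.
have e2 : modulus (rsum N g z v) <= modulus v * M.
  by apply: b => j hj; rewrite addrC addKr (le_trans (rsum_point v hj)) // lerDr.
have e3 : modulus (rsum N g (z + u) v) <= modulus v * M.
  apply: b => j hj; rewrite addrAC (addrAC z) subrr add0r (le_trans (modulusD _ _)) //.
  by rewrite lerD2l (rsum_point v hj).
have e4 : modulus (rsum N g (z + v) u) <= modulus u * M.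
  apply: b => j hj; rewrite addrAC (addrAC z) subrr add0r (le_trans (modulusD _ _)) //.
  by rewrite addrC lerD2r (rsum_point u hj).
rewrite /boundary.
apply: (le_trans (modulusD _ _)); rewrite modulusN.
apply: (le_trans (lerD (modulusD _ _) (lexx _))); rewrite modulusN.
apply: (le_trans (lerD (lerD (modulusD _ _) (lexx _)) (lexx _))).
by move: e1 e2 e3 e4; lra.
Qed.

(** Near a point t the function differs from an affine one by e |z - t|, so the
    discrete contour integral of a cell of size 2^-k is at most a constant times
    e 4^-k, uniformly in N.  Bisection spreads this bound to the whole
    parallelogram. *)
Theorem goursat g : (forall z, exists d, has_deriv g z d) ->
  forall z u v, tends (fun N => boundary N g z u v) 0.
Proof.
move=> hg z0 u v.
set L := modulus u + modulus v.
have L0 : 0 <= L by rewrite addr_ge0 ?modulus_ge0.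
have two0 k : (2 ^+ k : C) != 0 by rewrite expf_neq0.
suff H (eta : R) : 0 < eta -> exists N0, forall N, (N0 <= N)%N ->
    modulus (boundary N g z0 (u / 2 ^+ 0) (v / 2 ^+ 0)) <= eta / 4 ^+ 0.
  move=> e e0; have [|N0 hN0] := H (e / 2); first by rewrite divr_gt0.
  exists N0 => n /hN0; rewrite !expr0 !divr1 subr0 => /le_lt_trans; apply.
  by rewrite ltr_pdivrMr // ltr_pMr // ltr1n.
move=> eta0.
pose B k z := exists N0, forall N, (N0 <= N)%N ->
  modulus (boundary N g z (u / 2 ^+ k) (v / 2 ^+ k)) <= eta / 4 ^+ k.
apply: (@bisection R u v B) => [k z [N1 h1] [N2 h2] [N3 h3] [N4 h4]|t].
  exists (maxn (maxn N1 N2) (maxn N3 N4)).+1 => [] [//|N].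
  rewrite ltnS !geq_max => /andP[/andP[/h1 {}h1 /h2 {}h2] /andP[/h3 {}h3 /h4 {}h4]].
  rewrite boundary_split.
  have half (a : C) : a / 2 ^+ k / 2 = a / 2 ^+ k.+1 by rewrite exprS; field.
  rewrite !half.
  apply: (le_trans (modulusD _ _)); apply: (le_trans (lerD (modulusD _ _) (lexx _))).
  apply: (le_trans (lerD (lerD (modulusD _ _) (lexx _)) (lexx _))).
  have -> : eta / 4 ^+ k = 4 * (eta / 4 ^+ k.+1) by rewrite exprS; field; rewrite expf_neq0.
  by move: h1 h2 h3 h4; lra.
have [d hd] := hg t.
have e0 : 0 < eta / (4 * L ^+ 2 + 1) by rewrite divr_gt0 // ltr_wpDl // mulr_ge0 ?sqr_ge0.
have [r r0 hr] := hd _ e0.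
exists (r / 2); first by rewrite divr_gt0.
move=> k z; rewrite -/L => hz hk; exists 0%N => N _.
set q : R := 2 ^+ k in hz hk; have q0 : 0 < q by rewrite exprn_gt0.
have mq (a : C) : modulus (a / 2 ^+ k) = modulus a / q by rewrite modulusM modulusV modulusX modulus_nat.
have -> : boundary N g z (u / 2 ^+ k) (v / 2 ^+ k) =
    boundary N (fun w => g w - ((g t - d * t) + d * w)) z (u / 2 ^+ k) (v / 2 ^+ k).
  by rewrite boundaryB boundary_affine subr0.
apply: (le_trans (@boundary_bound _ _ _ _ _ (eta / (4 * L ^+ 2 + 1) * (2 * (L / q))) _)).
  move=> w; rewrite !mq -mulrDl -/L => hw.
  have hw2 : modulus (w - t) <= 2 * (L / q).
    have -> : w - t = (w - z) + (z - t) by ring.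
    by apply: (le_trans (modulusD _ _)); move: hw hz; lra.
  have := hr (w - t); rewrite (addrC t) subrK.
  have -> : g w - (g t - d * t + d * w) = g w - g t - d * (w - t) by ring.
  move=> /(_ _)/le_trans -> //; last by rewrite ler_wpM2l // ltW.
  by apply: le_lt_trans hw2 _; rewrite mulrC -ltr_pdivlMr.
rewrite !mq -mulrDl -/L.
have -> : 4 ^+ k = q ^+ 2 by rewrite /q -exprM mulnC exprM; congr (_ ^+ _); ring.
set D := 4 * L ^+ 2 + 1; have D0 : 0 < D by rewrite ltr_wpDl // mulr_ge0 ?sqr_ge0.
have -> : 2 * (L / q) * (eta / D * (2 * (L / q))) = eta / q ^+ 2 * ((4 * L ^+ 2) / D).
  by field; rewrite !gt_eqF.
rewrite ler_piMr ?divr_ge0 ?sqr_ge0 ?(ltW eta0) //.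
by rewrite ler_pdivrMr // mul1r lerDl.
Qed.

(** Bisection replaces uniform continuity: on a cell near t every sum is close to
    the length of the cell times g t. *)
Theorem rsum_cauchy g : (forall z (e : R), 0 < e ->
    exists2 r : R, 0 < r & forall h, modulus h < r -> modulus (g (z + h) - g z) <= e) ->
  forall z u, exists l, tends (fun N => rsum N g z u) l.
Proof.
move=> hg z0 u; apply: is_cauchy_tends => e e0.
pose B k z := exists N0, forall N M, (N0 <= N)%N -> (N0 <= M)%N ->
  modulus (rsum N g z (u / 2 ^+ k) - rsum M g z (u / 2 ^+ k)) <= e / 2 ^+ k.
suff [N0 H] : B 0%N z0.
  exists N0 => n hn; have := H n N0 hn (leqnn _).
  by rewrite expr0 !divr1.
apply: (@bisection R u 0 B) => [k z [N1 h1] [N2 h2] _ _|t].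
  exists (maxn N1 N2).+1 => [] [//|N] [//|M].
  rewrite !ltnS !geq_max => /andP[a1 a2] /andP[b1 b2].
  rewrite !rsum_split.
  have half (a : C) : a / 2 ^+ k / 2 = a / 2 ^+ k.+1.
    by rewrite exprS; field; rewrite expf_neq0.
  rewrite !half opprD addrACA.
  apply: (le_trans (modulusD _ _)).
  have := h1 _ _ a1 b1; have := h2 _ _ a2 b2.
  have -> : e / 2 ^+ k = 2 * (e / 2 ^+ k.+1) by rewrite exprS; field; rewrite expf_neq0.
  lra.
rewrite modulus0 addr0.
have U0 : 0 < 2 * modulus u + 1 by rewrite ltr_wpDl // mulr_ge0 ?modulus_ge0.
have [r r0 hr] := hg t _ (divr_gt0 e0 U0).
exists (r / 2); first by rewrite divr_gt0.
move=> k z hz hk; exists 0%N => N M _ _.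
set q : R := 2 ^+ k in hz hk *; have q0 : 0 < q by rewrite exprn_gt0.
have mq (a : C) : modulus (a / 2 ^+ k) = modulus a / q by rewrite modulusM modulusV modulusX modulus_nat.
have K n : modulus (rsum n g z (u / 2 ^+ k) - u / 2 ^+ k * g t) <= modulus u / q * (e / (2 * modulus u + 1)).
  rewrite -(rsum_cst n (g t) z (u / 2 ^+ k)) -rsumB -mq; apply: rsum_bound => j hj.
  have := @hr (z + u / 2 ^+ k * j%:R / 2 ^+ n - t); rewrite (addrC t) subrK; apply.
  have -> : z + u / 2 ^+ k * j%:R / 2 ^+ n - t = (z - t) + u / 2 ^+ k * j%:R / 2 ^+ n by ring.
  apply: (le_lt_trans (modulusD _ _)).
  have := rsum_point (u / 2 ^+ k) hj; rewrite mq => h.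
  by move: hz hk h; lra.
have -> : rsum N g z (u / 2 ^+ k) - rsum M g z (u / 2 ^+ k) =
  (rsum N g z (u / 2 ^+ k) - u / 2 ^+ k * g t) - (rsum M g z (u / 2 ^+ k) - u / 2 ^+ k * g t) by ring.
apply: (le_trans (modulusD _ _)); rewrite modulusN.
apply: (le_trans (lerD (K N) (K M))).
set D := 2 * modulus u + 1 in U0 *.
have -> : modulus u / q * (e / D) + modulus u / q * (e / D) = e / q * (2 * modulus u / D).
  by field; rewrite !gt_eqF.
rewrite ler_piMr ?divr_ge0 ?(ltW e0) ?(ltW q0) //.
by rewrite ler_pdivrMr // mul1r lerDl.
Qed.

End Riemann.

(** * The complex exponential *)

Section Exponential.
Variable R : realType.
Local Notation C := (Cplx R).

Definition cexp (w : C) : C :=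
  let: a +i* b := (w : R[i]) in
  ((expR a * cos b) +i* (expR a * sin b) : R[i]).

Lemma cexpD (w w' : C) : cexp (w + w') = cexp w * cexp w'.
Proof.
case: w w' => [a b] [c d]; apply/eqP; rewrite eq_complex /= expRD cosD sinD.
by apply/andP; split; apply/eqP; ring.
Qed.

Lemma cexp0 : cexp 0 = 1.
Proof. by apply/eqP; rewrite eq_complex /= expR0 cos0 sin0 mulr1 mulr0 !eqxx. Qed.

Lemma cexp_neq0 w : cexp w != 0.
Proof.
apply/eqP => h; have := cexpD w (- w).
by rewrite subrr cexp0 h mul0r => /eqP; rewrite oner_eq0.
Qed.

Definition twopii : C := (0 +i* (pi *+ 2) : R[i]).

Lemma twopii_neq0 : twopii != 0.
Proof.
by rewrite eq_complex /= eqxx /= gt_eqF // mulrn_wgt0 // pi_gt0.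
Qed.

Lemma cexp_twopii : cexp twopii = 1.
Proof. by apply/eqP; rewrite eq_complex /= expR0 cos2pi sin2pi mulr1 mulr0 !eqxx. Qed.

Lemma cexp_mulrn w n : cexp (w * n%:R) = cexp w ^+ n.
Proof.
elim: n => [|n IH]; first by rewrite mulr0 cexp0.
by rewrite -natr1 mulrDr mulr1 cexpD IH exprSr.
Qed.

(** Polar coordinates; the sign of the imaginary part selects one of the angles +-acos. *)
Lemma cexp_surj (z : C) : z != 0 -> exists w, cexp w = z.
Proof.
move=> z0; have r0 : 0 < modulus z by rewrite modulus_gt0.
suff [b [hc hs]] : exists b : R, complex.Re (z : R[i]) = modulus z * cos b /\
    complex.Im (z : R[i]) = modulus z * sin b.
  exists (ln (modulus z) +i* b : R[i]); apply/eqP.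
  rewrite [eqbRHS](_ : z = (complex.Re (z : R[i]) +i* complex.Im (z : R[i]) : R[i])); last by case: (z).
  by rewrite eq_complex /= lnK ?posrE // -hc -hs !eqxx.
case: z z0 r0 => x y z0; rewrite /modulus /=; set r := Num.sqrt _ => r0.
have r2 : r ^+ 2 = x ^+ 2 + y ^+ 2 by rewrite sqr_sqrtr // addr_ge0 ?sqr_ge0.
have rn : r != 0 by rewrite gt_eqF.
have xr : -1 <= x / r <= 1.
  rewrite -ler_norml normrM normfV (gtr0_norm r0) ler_pdivrMr // mul1r.
  by rewrite -sqrtr_sqr ler_wsqrtr // lerDl sqr_ge0.
have hs : (r * sin (acos (x / r))) = `|y|.
  rewrite sin_acos // -[X in X * _](gtr0_norm r0) -[X in X * _]sqrtr_sqr.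
  rewrite -sqrtrM ?sqr_ge0 // -sqrtr_sqr; congr Num.sqrt.
  by rewrite mulrBr mulr1 expr_div_n mulrCA mulfV ?sqrf_eq0 // r2; ring.
have [y0|y0] := leP 0 y.
  exists (acos (x / r)); rewrite acosK ?in_itv //; split; first by field.
  by rewrite hs ger0_norm.
exists (- acos (x / r)); rewrite cosN sinN acosK ?in_itv //; split; first by field.
by rewrite mulrN hs ltr0_norm // opprK.
Qed.

Lemma real_deriv0 (f : R -> R) (d : R) : is_derive (0 : R) (1 : R) f d ->
  forall e : R, 0 < e -> exists2 r : R, 0 < r & forall h, `|h| < r -> `|f h - f 0 - d * h| <= e * `|h|.
Proof.
move=> [/cvgrPdist_le H dE] e e0.
have [r /= r0 hr] := H e e0; exists r => // h hh.
have [->|h0] := eqVneq h 0; first by rewrite mulr0 subrr subr0 normr0 mulr0.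
have := hr h; rewrite /ball_ /= sub0r normrN => /(_ hh h0).
rewrite -[lim _]/('D_1 f 0) dE => h1.
have -> : f h - f 0 - d * h = - ((d - h^-1 *: (f (h *: 1 + 0) - f 0)) * h).
  rewrite addr0 -[h *: 1]/(h * 1) mulr1 mulrBl -[h^-1 *: _]/(h^-1 * _) mulrAC mulVf ?mul1r //.
  by rewrite opprB.
by rewrite normrN normrM ler_wpM2r.
Qed.

(** Reduces to the real derivatives of expR, cos and sin at 0, by splitting
    e^a cos b - 1 - a and e^a sin b - b into products of small increments. *)
Lemma cexp_deriv0 : has_deriv cexp 0 1.
Proof.
move=> e e0.
have [e' [e'0 e1 e8]] : exists e' : R, [/\ 0 < e', e' <= 1 & e' * 8 <= e].
  exists (Num.min (e / 8) 1); split; first by rewrite lt_min divr_gt0 /=.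
    by rewrite ge_min lexx orbT.
  by rewrite -ler_pdivlMr // ge_min lexx.
have [r1 r10 h1] := real_deriv0 (is_derive_expR 0) e'0.
have [r2 r20 h2] := real_deriv0 (is_derive_cos 0) e'0.
have [r3 r30 h3] := real_deriv0 (is_derive_sin 0) e'0.
(* e' is one eighth of e: the error terms below add up to at most 8 e' |h| *)
exists (Num.min e' (Num.min r1 (Num.min r2 r3))); first by rewrite lt_min e'0 lt_min r10 lt_min r20.
move=> h; rewrite !lt_min => /and4P[he hr1 hr2 hr3].
have ha := Re_le h; have hb := Im_le h.
rewrite add0r cexp0 mul1r.
apply: (le_trans (modulus_le _)).
move: he hr1 hr2 hr3 ha hb; set m := modulus h; case: h @m => a b m /= he hr1 hr2 hr3 ha hb.
have {}h1 := h1 _ (le_lt_trans ha hr1); have {}h2 := h2 _ (le_lt_trans hb hr2).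
have {}h3 := h3 _ (le_lt_trans hb hr3).
rewrite expR0 mul1r in h1; rewrite cos0 sin0 oppr0 mul0r subr0 in h2.
rewrite sin0 cos0 mul1r subr0 in h3.
have c1 := cos_max b.
have m0 : 0 <= m by apply: modulus_ge0.
have A0 := normr_ge0 a; have B0 := normr_ge0 b.
have -> : expR a * cos b - 1 - a = (expR a - 1 - a) * cos b + (1 + a) * (cos b - 1) by ring.
have -> : expR a * sin b - 0 - b = (expR a - 1 - a) * sin b + a * sin b + (sin b - b) by ring.
have s1 : `|sin b| <= 2 * `|b|.
  rewrite -[sin b](subrK b); apply: (le_trans (ler_normD _ _)); nra.
have t1 : `|(expR a - 1 - a) * cos b + (1 + a) * (cos b - 1)| <= e' * m + 2 * (e' * m).
  apply: (le_trans (ler_normD _ _)); rewrite !normrM.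
  have a1 : `|1 + a| <= 2 by apply: (le_trans (ler_normD _ _)); rewrite normr1; nra.
  have := normr_ge0 (expR a - 1 - a); have := normr_ge0 (cos b - 1).
  have := normr_ge0 (cos b); have := normr_ge0 (1 + a) => *; apply: lerD.
    apply: (@le_trans _ _ (`|expR a - 1 - a| * 1)); first by rewrite ler_wpM2l.
    by rewrite mulr1 (le_trans h1) // ler_wpM2l // ltW.
  apply: ler_pM => //; apply: (le_trans h2); rewrite ler_wpM2l //; exact: ltW.
have t2 : `|(expR a - 1 - a) * sin b + a * sin b + (sin b - b)| <= 2 * (e' * m) + 2 * (e' * m) + e' * m.
  apply: (le_trans (ler_normD _ _)); apply: lerD; last first.
    by apply: (le_trans h3); rewrite ler_wpM2l // ltW.
  have p1 : `|a| * `|sin b| <= 2 * (e' * m).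
    apply: (@le_trans _ _ (e' * (2 * m))); last lra.
    by apply: ler_pM => //; [apply: (le_trans ha (ltW he)) | apply: (le_trans s1); rewrite ler_wpM2l].
  apply: (le_trans (ler_normD _ _)); rewrite !normrM; apply: lerD => //.
  apply: le_trans p1; rewrite ler_wpM2r //; apply: (le_trans h1).
  by rewrite ler_piMl.
by nra.
Qed.

Lemma cexp_deriv (w : C) : has_deriv cexp w (cexp w).
Proof.
move=> e e0; have k0 : 0 < modulus (cexp w) by rewrite modulus_gt0 cexp_neq0.
have [r r0 hr] := cexp_deriv0 (divr_gt0 e0 k0).
exists r => // h /hr; rewrite add0r cexp0 mul1r cexpD => h1.
have -> : cexp w * cexp h - cexp w - cexp w * h = cexp w * (cexp h - 1 - h) by ring.
by rewrite modulusM mulrC -ler_pdivlMr // mulrAC.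
Qed.

End Exponential.

(** * Mean values over circles *)

Section CircleMean.
Variable R : realType.
Local Notation C := (Cplx R).

Definition dyadic_root N : C := cexp (twopii R / 2 ^+ N).

Lemma dyadic_root_neq0 N : dyadic_root N != 0. Proof. exact: cexp_neq0. Qed.

Lemma dyadic_root_pow N : dyadic_root N ^+ (2 ^ N) = 1.
Proof.
have q0 : (2 ^+ N : C) != 0 by rewrite expf_neq0.
by rewrite -cexp_mulrn natrX divfK // cexp_twopii.
Qed.

Definition circle_mean N (g : C -> C) (z : C) : C :=
  (2 ^+ N)^-1 * \sum_(j < 2 ^ N) g (z * dyadic_root N ^+ j).

Lemma circle_mean_rsum N g w : rsum N (g \o @cexp R) w (twopii R) = twopii R * circle_mean N g (cexp w).
Proof.
rewrite /rsum /circle_mean mulrA; congr (_ * _); apply: eq_bigr => j _ /=.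
by rewrite cexpD /dyadic_root -cexp_mulrn; congr (g (_ * cexp _)); ring.
Qed.

Lemma holo_exp g : holo g -> forall w, exists d, has_deriv (g \o @cexp R) w d.
Proof.
move=> hg w; apply/derivable_has/derivable1_diffP.
apply: differentiable_comp; apply/derivable1_diffP.
  exact: has_derivable (cexp_deriv w).
exact/hg/cexp_neq0.
Qed.

(** The function w |-> g (e^w) is entire with period 2 pi i.  Goursat's theorem on
    the parallelogram with sides w and 2 pi i, whose sides parallel to w have equal
    sums by periodicity, shows that the mean does not depend on the starting point e^w.
    Since w is any complex number, this contains both the rotation and the
    dilation invariance of the mean. *)
Theorem circle_mean_tends g : holo g -> exists l, forall z, z != 0 -> tends (fun N => circle_mean N g z) l.
Proof.
move=> hg; have hG := holo_exp hg; set G := g \o _ in hG.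
have [l hl] : exists l, tends (fun N => rsum N G 0 (twopii R)) l.
  by apply: rsum_cauchy => z e e0; have [d /has_deriv_cont] := hG z; apply.
exists ((twopii R)^-1 * l) => z z0; have [w <-] := cexp_surj z0.
apply: tends_ext (_ : tends (fun N => (twopii R)^-1 * rsum N G w (twopii R)) _).
  by move=> N; rewrite circle_mean_rsum mulKf // twopii_neq0.
apply: tendsZ; apply: tends_near hl _.
apply: tends_ext (goursat hG 0 w (twopii R)) => N.
rewrite /boundary !add0r.
suff -> : rsum N G (twopii R) w = rsum N G 0 w by ring.
rewrite /rsum; congr (_ * _); apply: eq_bigr => j _.
by rewrite /G /= !cexpD cexp_twopii cexp0.
Qed.

End CircleMean.

(** * Uniqueness of Laurent expansions *)

Section Uniqueness.
Variable R : realType.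
Local Notation C := (Cplx R).
Implicit Types (f g : C -> C) (z w : C).

Lemma holoM f g : holo f -> holo g -> holo (fun z => f z * g z).
Proof. by move=> hf hg z z0; apply: derivableM; [apply: hf | apply: hg]. Qed.

Lemma holo_ext f g : f =1 g -> holo f -> holo g.
Proof. by move=> /funext ->. Qed.

Lemma holo_cst (c : C) : holo (fun=> c).
Proof. by move=> z _; apply: derivable_cst. Qed.

Lemma holo_id : holo (fun z : C => z).
Proof. by move=> z _; apply: derivable_id. Qed.

Lemma holoD f g : holo f -> holo g -> holo (fun z => f z + g z).
Proof. by move=> hf hg z z0; apply: derivableD; [apply: hf | apply: hg]. Qed.

Lemma holoV f : holo f -> (forall z, z != 0 -> f z != 0) -> holo (fun z => (f z)^-1).
Proof. by move=> hf f0 z z0; apply: derivableV; [apply: f0 | apply: hf]. Qed.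

Lemma holo_comp f g : holo f -> holo g -> (forall z, z != 0 -> g z != 0) -> holo (fun z => f (g z)).
Proof.
move=> hf hg g0 z z0; apply/derivable1_diffP.
apply: (@differentiable_comp _ _ _ _ g f); apply/derivable1_diffP; first exact: hg.
by apply: hf; apply: g0.
Qed.

Lemma holo_prod (I : Type) (r : seq I) (P : pred I) (F : I -> C -> C) :
  (forall i, P i -> holo (F i)) -> holo (fun z => \prod_(i <- r | P i) F i z).
Proof.
move=> h; elim: r => [|i r IH].
  by apply: (holo_ext _ (@holo_cst 1)) => z; rewrite big_nil.
apply: (@holo_ext (fun z => (if P i then F i z else 1) * \prod_(j <- r | P j) F j z)).
  by move=> z; rewrite big_cons; case: ifP => // _; rewrite mul1r.
by apply: holoM IH; case Pi: (P i); [apply: h | apply: holo_cst].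
Qed.

Lemma holo_sum (I : Type) (r : seq I) (P : pred I) (F : I -> C -> C) :
  (forall i, P i -> holo (F i)) -> holo (fun z => \sum_(i <- r | P i) F i z).
Proof.
move=> h; elim: r => [|i r IH].
  by apply: (holo_ext _ (@holo_cst 0)) => z; rewrite big_nil.
apply: (@holo_ext (fun z => (if P i then F i z else 0) + \sum_(j <- r | P j) F j z)).
  by move=> z; rewrite big_cons; case: ifP => // _; rewrite add0r.
by apply: holoD IH; case Pi: (P i); [apply: h | apply: holo_cst].
Qed.

Lemma holoX f n : holo f -> holo (fun z => f z ^+ n).
Proof.
move=> hf; elim: n => [|n IH]; first exact: holo_cst.
by apply: (holo_ext _ (holoM hf IH)) => z; rewrite exprS.
Qed.

Lemma holo_exprz (k : int) : holo (fun z : C => z ^ k).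
Proof.
case: k => n; first exact: (@holoX (fun z => z) n holo_id).
apply: (@holoV (fun z => z ^+ n.+1)); first exact: (@holoX (fun z => z) n.+1 holo_id).
by move=> z z0; rewrite expf_neq0.
Qed.

(** Local boundedness is inherited by the union of two halves, so bisection applies. *)
Lemma segment_bounded g : (forall z (e : R), 0 < e ->
    exists2 r : R, 0 < r & forall h, modulus h < r -> modulus (g (z + h) - g z) <= e) ->
  forall z (u : C), exists M : R, forall s : R, 0 <= s <= 1 -> modulus (g (z + u * ofR s)) <= M.
Proof.
move=> hg z0 u.
pose B k z := exists M : R, forall s : R, 0 <= s <= 1 -> modulus (g (z + u / 2 ^+ k * ofR s)) <= M.
suff [M H] : B 0%N z0 by exists M => s /H; rewrite expr0 divr1.
apply: (@bisection R u 0 B) => [k z [M1 h1] [M2 h2] _ _|t].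
  exists (Num.max M1 M2) => s /andP[s0 s1]; rewrite le_max.
  have q0 : (2 ^+ k : C) != 0 by rewrite expf_neq0.
  have ofR2 (r : R) : ofR (2 * r) = 2 * ofR r by rewrite /ofR rmorphM rmorph_nat.
  have ofR1 : ofR (1 : R) = 1 by [].
  have [hs|hs] := leP s (1 / 2); apply/orP; [left|right].
    have := h1 (2 * s); have -> : u / 2 ^+ k.+1 * ofR (2 * s) = u / 2 ^+ k * ofR s.
      by rewrite ofR2 exprS; field.
    by apply; apply/andP; split; lra.
  have := h2 (2 * s - 1).
  have -> : z + u / 2 ^+ k.+1 + u / 2 ^+ k.+1 * ofR (2 * s - 1) = z + u / 2 ^+ k * ofR s.
    have -> : ofR (2 * s - 1) = 2 * ofR s - 1 by rewrite /ofR rmorphB rmorphM rmorph_nat.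
    by rewrite exprS; field.
  by apply; apply/andP; split; lra.
rewrite modulus0 addr0; have [r r0 hr] := hg t 1 ltr01.
exists (r / 2); first by rewrite divr_gt0.
move=> k z hz hk; exists (modulus (g t) + 1) => s /andP[s0 s1].
set y := z + _; have := hr (y - t); rewrite (addrC t) subrK.
have hy : modulus (y - t) < r.
  have -> : y - t = (z - t) + u / 2 ^+ k * ofR s by rewrite /y; ring.
  apply: (le_lt_trans (modulusD _ _)); rewrite !modulusM modulusV modulusX modulus_nat ofR_mod //.
  have k0 : 0 <= modulus u / 2 ^+ k by rewrite divr_ge0 ?modulus_ge0 ?exprn_ge0.
  have : modulus u / 2 ^+ k * s <= modulus u / 2 ^+ k by rewrite ler_piMr.
  by move: hz hk; lra.
move=> /(_ hy) h; rewrite -[g y](subrK (g t)) (le_trans (modulusD _ _)) //.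
by rewrite addrC lerD2l.
Qed.

Lemma modulus_dyadic_root N j : modulus (dyadic_root R N ^+ j) = 1.
Proof.
rewrite modulusX; suff -> : modulus (dyadic_root R N) = 1 by rewrite expr1n.
apply/eqP; rewrite -(@pexpr_eq1 _ _ (2 ^ N)) ?modulus_ge0 ?expn_gt0 //.
by rewrite -modulusX dyadic_root_pow modulus1.
Qed.

(** For |w| = 1 the Laurent polynomial (2 + w + 1/w) / 4 is real, lies between
    0 and 1 and is largest at w = 1. *)
Lemma unit_peak (w : C) : modulus w = 1 ->
  w^-1 * (1 + w) ^+ 2 / 4 = ofR (1 - modulus (w - 1) ^+ 2 / 4).
Proof.
move=> w1; have w0 : w != 0 by rewrite -modulus_gt0 w1.
have four : (4 : C) != 0 by rewrite pnatr_eq0.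
suff H : (1 + w) ^+ 2 = w * (4 * ofR (1 - modulus (w - 1) ^+ 2 / 4)) by rewrite H; field; rewrite w0.
have -> : 4 * ofR (1 - modulus (w - 1) ^+ 2 / 4) = ofR (4 - modulus (w - 1) ^+ 2).
  have -> : 4 = ofR (4 : R) by rewrite /ofR rmorph_nat.
  by rewrite /ofR -rmorphM; congr (_%:C); field.
case: w w1 w0 => a b; rewrite /modulus /= => w1 _.
have ab : a ^+ 2 + b ^+ 2 = 1 by rewrite -[LHS]sqr_sqrtr ?addr_ge0 ?sqr_ge0 // w1 expr1n.
rewrite sqr_sqrtr ?addr_ge0 ?sqr_ge0 // /ofR expr2.
have -> : (a - 1) ^+ 2 + (b - 0) ^+ 2 = 2 - 2 * a by move: ab; lra.
apply/eqP; rewrite eq_complex /=; apply/andP; split; apply/eqP; move: ab; lra.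
Qed.

Lemma Re_sum (I : Type) (r : seq I) (F : I -> C) :
  complex.Re (\sum_(i <- r) F i : R[i]) = \sum_(i <- r) complex.Re (F i : R[i]).
Proof. by apply: (big_morph (fun z : C => complex.Re (z : R[i]))) => // [[a b] [c d]]. Qed.

Lemma Re_mulr (z : C) (r : R) : complex.Re (z * ofR r : R[i]) = complex.Re (z : R[i]) * r.
Proof. by case: z => a b /=; ring. Qed.

Lemma pow_gap (q Q c : R) : 0 <= q < Q -> 0 < c -> exists m, q ^+ m < c * Q ^+ m.
Proof.
move=> /andP[q0 qQ] c0; have Q0 : 0 < Q by apply: le_lt_trans q0 qQ.
have h : (`|q / Q| < 1).
  by rewrite ger0_norm ?divr_ge0 // ?(ltW Q0) // ltr_pdivrMr // mul1r.
have /cvgrPdist_lt/(_ c c0)[m _ /(_ m (leqnn m))] := cvg_expr h.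
rewrite sub0r normrN ger0_norm ?exprn_ge0 ?divr_ge0 ?(ltW Q0) // expr_div_n ltr_pdivrMr ?exprn_gt0 //.
by exists m.
Qed.

(** If f z0 is not 0, multiply f (z0 w) / f z0 by a high power of the peak of
    [unit_peak].  The product is a combination of monomials times f, so its means
    tend to 0.  But near w = 1 its real part is at least half of the power of the
    peak, and elsewhere the power of the peak is negligible, so the means stay
    bounded below. *)
Theorem laurent_unique f : holo f ->
  (forall (k : int) z, z != 0 -> tends (fun N => circle_mean N (fun w => f w * w ^ k) z) 0) ->
  forall z, z != 0 -> f z = 0.
Proof.
move=> hf hk z0 z0n; apply/eqP; apply: contrapT => /negP fz.
have mz : 0 < modulus z0 by rewrite modulus_gt0.
have mf : 0 < modulus (f z0) by rewrite modulus_gt0.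
pose F w := f (z0 * w) / f z0.
have [M hM] : exists M : R, forall N j, (j < 2 ^ N)%N -> modulus (F (dyadic_root R N ^+ j)) <= M.
  have [w1 hw1] := cexp_surj z0n.
  have [M hM] := @segment_bounded (f \o @cexp R)
    (fun z e e0 => let: ex_intro d hd := holo_exp hf z in has_deriv_cont hd e0) w1 (twopii R).
  exists (M / modulus (f z0)) => N j hj; rewrite modulusM modulusV ler_pM2r ?invr_gt0 //.
  have := hM (j%:R / 2 ^+ N); rewrite /= cexpD hw1.
  have -> : twopii R * ofR (j%:R / 2 ^+ N) = twopii R / 2 ^+ N * j%:R.
    by rewrite /ofR rmorphM fmorphV rmorphXn !rmorph_nat; ring.
  rewrite cexp_mulrn; apply; rewrite divr_ge0 ?ler0n ?exprn_ge0 //=.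
  by rewrite ler_pdivrMr ?exprn_gt0 // mul1r -natrX ler_nat ltnW.
have M0 : 0 <= M by apply: le_trans (hM 0%N 0%N isT); apply: modulus_ge0.
have [d [d0 d1 hd]] : exists d : R, [/\ 0 < d, d <= 1 &
    forall w, modulus (w - 1) < d -> 1 / 2 <= complex.Re (F w : R[i])].
  have [dd /has_deriv_cont/(_ (modulus (f z0) / 2))] := derivable_has (hf _ z0n).
  move=> [|r r0 hr]; first by rewrite divr_gt0.
  exists (Num.min 1 (r / modulus z0)); split; first by rewrite lt_min ltr01 divr_gt0.
    by rewrite ge_min lexx.
  move=> w; rewrite lt_min => /andP[_]; rewrite ltr_pdivlMr // -modulusM => h.
  have := hr ((w - 1) * z0) h.
  have -> : z0 + (w - 1) * z0 = z0 * w by ring.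
  have -> : f (z0 * w) - f z0 = (F w - 1) * f z0 by rewrite /F; field.
  rewrite modulusM mulrC ler_pM2l // => h2.
  have := le_trans (Re_le (F w - 1)) h2.
  have -> : complex.Re (F w - 1 : R[i]) = complex.Re (F w : R[i]) - 1 by case: (F w).
  by rewrite ler_norml => /andP[]; lra.
have d20 : 0 < d / 2 by rewrite divr_gt0.
(* a fixed proportion 2^-K of the points of each circle is within d / 2 of 1 *)
have [K hK] : exists K, forall N j, (K <= N)%N -> (j < 2 ^ (N - K))%N -> modulus (dyadic_root R N ^+ j - 1) <= d / 2.
  have [r r0 hr] := has_deriv_cont (@cexp_deriv R 0) d20.
  have [K hK] := small_pow2 (modulus (twopii R)) r0.
  exists K => N j hN hj; rewrite /dyadic_root -cexp_mulrn.
  have := hr (twopii R / 2 ^+ N * j%:R); rewrite add0r cexp0; apply.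
  rewrite !modulusM modulusV modulusX !modulus_nat; apply: le_lt_trans (hK K (leqnn K)).
  rewrite -mulrA ler_wpM2l ?modulus_ge0 // mulrC ler_pdivrMr ?exprn_gt0 //.
  have -> : (2 : R) ^+ N = 2 ^+ K * 2 ^+ (N - K) by rewrite -exprD subnKC.
  by rewrite mulKf ?expf_neq0 // -natrX ler_nat ltnW.
(* Q bounds the peak below within d / 2 of 1, and q bounds it above at distance d or more *)
pose q := 1 - d ^+ 2 / 4; pose Q := 1 - (d / 2) ^+ 2 / 4.
have dd1 : d ^+ 2 <= 1 by rewrite expr_le1 // ltW.
have dd0 : 0 < d ^+ 2 by rewrite exprn_gt0.
have qQ : 0 <= q < Q by rewrite /q /Q expr_div_n; apply/andP; split; lra.
have Q0 : 0 < Q by case/andP: qQ => h1 h2; apply: le_lt_trans h1 h2.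
have p2 k : 0 < (2 : R) ^+ k by rewrite exprn_gt0.
have M1 : 0 < M + 1 by rewrite ltr_wpDl.
have c0 : 0 < (4 * 2 ^+ K * (M + 1))^-1 by rewrite invr_gt0 !mulr_gt0.
have [m hm] := pow_gap qQ c0.
pose tau w := 1 - modulus (w - 1) ^+ 2 / 4.
have tau0 N j : 0 <= tau (dyadic_root R N ^+ j).
  rewrite /tau subr_ge0 ler_pdivrMr // mul1r.
  have -> : (4 : R) = 2 ^+ 2 by ring.
  rewrite lerXn2r ?nnegrE ?modulus_ge0 //.
  apply: (le_trans (modulusD _ _)); rewrite modulusN modulus1 modulus_dyadic_root; lra.
pose U N : C := (2 ^+ N)^-1 * \sum_(j < 2 ^ N) F (dyadic_root R N ^+ j) * ofR (tau (dyadic_root R N ^+ j) ^+ m).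
(* expand the m-th power of the peak into monomials *)
have hU : tends U 0.
  have H : tends (fun N => \sum_(k < (2 * m).+1) ('C(2 * m, k)%:R / 4 ^+ m / f z0 * z0 ^ (m%:Z - k%:Z)) *
      circle_mean N (fun w => f w * w ^ (k%:Z - m%:Z)) z0) (\sum_(k < (2 * m).+1)
      ('C(2 * m, k)%:R / 4 ^+ m / f z0 * z0 ^ (m%:Z - k%:Z)) * 0).
    by apply: tends_sum => k; apply: tendsZ; apply: hk.
  have -> : 0 = \sum_(k < (2 * m).+1) ('C(2 * m, k)%:R / 4 ^+ m / f z0 * z0 ^ (m%:Z - k%:Z)) * 0 :> C.
    by rewrite big1 // => k _; rewrite mulr0.
  apply: tends_ext H => N.
  rewrite /U /circle_mean.
  under eq_bigr do rewrite mulrCA.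
  rewrite -mulr_sumr; congr (_ * _).
  under eq_bigr do rewrite mulr_sumr.
  rewrite exchange_big; apply: eq_bigr => j _ /=.
  set w := dyadic_root R N ^+ j; have w0 : w != 0 by rewrite expf_neq0 // dyadic_root_neq0.
  have -> : ofR (tau w ^+ m) = ofR (tau w) ^+ m by rewrite /ofR rmorphXn.
  rewrite /tau -unit_peak ?modulus_dyadic_root // exprMn exprMn -exprM [(1 + w) ^+ _]exprDn !exprVn.
  rewrite mulr_sumr mulr_suml mulr_sumr; apply: eq_bigr => k _.
  rewrite expr1n mul1r exprzMl ?unitfE // /F.
  have e1 (a : C) : a != 0 -> a ^ (k%:Z - m%:Z) = a ^+ k / a ^+ m.
    by move=> a0; rewrite expfzDr // -exprnP -invr_expz.
  have -> : z0 ^ (m%:Z - k%:Z) = (z0 ^ (k%:Z - m%:Z))^-1 by rewrite -opprB invr_expz.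
  rewrite !e1 // -[w ^+ k *+ _]mulr_natl; field.
  by rewrite fz !expf_neq0 // dyadic_root_neq0.
have low0 : 0 < (2 ^+ K)^-1 * Q ^+ m / 4 by rewrite !mulr_gt0 ?invr_gt0 ?exprn_gt0.
have [N0 hN0] := hU _ low0.
pose N := maxn N0 K; have hKN : (K <= N)%N by apply: leq_maxr.
have := hN0 N (leq_maxl _ _); rewrite subr0; apply/negP; rewrite -leNgt.
apply: le_trans (le_trans (ler_norm _) (Re_le _)).
have -> : U N = (\sum_(j < 2 ^ N) F (dyadic_root R N ^+ j) * ofR (tau (dyadic_root R N ^+ j) ^+ m)) * ofR (2 ^+ N)^-1.
  by rewrite mulrC /U; congr (_ * _); rewrite /ofR fmorphV rmorphXn rmorph_nat.
rewrite Re_mulr Re_sum ler_pdivlMr ?p2 //.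
(* the real part of each term of the mean is at least b j *)
pose b j := 1 / 2 * Q ^+ m * ((j < 2 ^ (N - K))%N)%:R - M * q ^+ m.
apply: (@le_trans _ _ (\sum_(j < 2 ^ N) b j)).
  rewrite sumrB -mulr_sumr -natr_sum sumr_const card_ord.
  have -> : (\sum_(j < 2 ^ N) (j < 2 ^ (N - K)))%N = (2 ^ (N - K))%N.
    rewrite -big_mkcond /= -(big_ord_widen _ (fun=> 1%N)) ?leq_exp2l ?leq_subr //.
    by rewrite sum_nat_const card_ord muln1.
  rewrite -[_ *+ (2 ^ N)]mulr_natr !natrX.
  have -> : (2 : R) ^+ N = 2 ^+ K * 2 ^+ (N - K) by rewrite -exprD subnKC.
  move: hm; rewrite mulrC ltr_pdivlMr ?mulr_gt0 // => hm.
  have A0 := p2 K; have B0 := p2 (N - K)%N; have qm : 0 <= q ^+ m by case/andP: qQ => ? _; rewrite exprn_ge0.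
  move: (2 ^+ K) (2 ^+ (N - K)) (q ^+ m) (Q ^+ m) A0 B0 qm hm => A B qm Qm A0 B0 qm0 hm.
  have -> : A^-1 * Qm / 4 * (A * B) = Qm / 4 * B by field; rewrite gt_eqF.
  have -> : 1 / 2 * Qm * B - M * qm * (A * B) = (1 / 2 * Qm - M * qm * A) * B by ring.
  rewrite ler_pM2r //; have : 0 <= qm * A by rewrite mulr_ge0 // ltW.
  by move: hm; lra.
apply: ler_sum => j _; rewrite Re_mulr /b.
have jN := ltn_ord j; set w := dyadic_root R N ^+ j; have t0 : 0 <= tau w := tau0 N j.
have [q0 qQ'] := andP qQ.
have Mq : 0 <= M * q ^+ m by rewrite mulr_ge0 ?exprn_ge0.
have [hw|hw] := ltP (modulus (w - 1)) d.
  have hF := hd _ hw.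
  have tm : 0 <= tau w ^+ m by rewrite exprn_ge0.
  have [hj|hj] := boolP (j < 2 ^ (N - K))%N; last by rewrite mulr0; nra.
  have : Q ^+ m <= tau w ^+ m.
    apply: lerXn2r; rewrite ?nnegrE ?(ltW Q0) // /Q /tau lerD2l lerN2 ler_pM2r //.
    by rewrite lerXn2r ?nnegrE ?modulus_ge0 ?(ltW d20) ?hK.
  by rewrite mulr1; nra.
have -> : (j < 2 ^ (N - K))%N = false.
  by apply/negP => /(hK N _ hKN); rewrite -/w; lra.
rewrite mulr0 sub0r.
have tq : tau w ^+ m <= q ^+ m.
  apply: lerXn2r; rewrite ?nnegrE // /q /tau lerD2l lerN2 ler_pM2r //.
  by rewrite lerXn2r ?nnegrE ?modulus_ge0 ?(ltW d0).
have := le_trans (Re_le _) (hM N j jN); rewrite -/w ler_norml => /andP[hF _].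
have tm : 0 <= tau w ^+ m by rewrite exprn_ge0.
rewrite lerNl -mulNr; apply: (@le_trans _ _ (M * tau w ^+ m)); first by rewrite ler_wpM2r // lerNl.
by rewrite ler_wpM2l.
Qed.

End Uniqueness.

(** * The infinite product and the theta function *)

Section Pochhammer.
Variable R : realType.
Local Notation C := (Cplx R).
Variable p : C.
Hypothesis hp : 0 < `|p| < 1.

Lemma modulus_p : 0 < modulus p < 1.
Proof. by move: hp; rewrite modulusE ofR_gt0 -(ofR_lt _ 1). Qed.

Let r := modulus p.
Let r0 : 0 < r. Proof. by case/andP: modulus_p. Qed.
Let r1 : r < 1. Proof. by case/andP: modulus_p. Qed.
Let r1' : 0 < 1 - r. Proof. by rewrite subr_gt0. Qed.

Lemma p_neq0 : p != 0.
Proof. by rewrite -modulus_gt0. Qed.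

(** All limits below are geometric: the N-th increment is O(|p|^N). *)
Lemma geometric_cauchy (u : nat -> C) (K : R) :
  (forall n, modulus (u n.+1 - u n) <= K * r ^+ n) -> exists l, tends u l.
Proof.
move=> h; have K0 : 0 <= K.
  by have := h 0%N; rewrite expr0 mulr1; apply: le_trans; apply: modulus_ge0.
have tele n k : modulus (u (n + k)%N - u n) <= K / (1 - r) * (r ^+ n - r ^+ (n + k)).
  elim: k => [|k IH]; first by rewrite addn0 !subrr modulus0 mulr0.
  rewrite addnS; have -> : u (n + k).+1 - u n = (u (n + k).+1 - u (n + k)%N) + (u (n + k)%N - u n) by ring.
  apply: (le_trans (modulusD _ _)); apply: (le_trans (lerD (h _) IH)).
  rewrite le_eqVlt; apply/orP; left; apply/eqP; rewrite exprS; field.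
  by rewrite gt_eqF.
apply: is_cauchy_tends => e e0.
have c0 : 0 < e * (1 - r) / (K + 1) by rewrite divr_gt0 ?mulr_gt0 // ltr_wpDl.
have [N hN] : exists N, r ^+ N < e * (1 - r) / (K + 1).
  have [|m] := @pow_gap R r 1 _ _ c0; first by rewrite (ltW r0).
  by rewrite expr1n mulr1; exists m.
exists N => n /subnKC <-; apply: (le_trans (tele _ _)).
apply: (@le_trans _ _ (K / (1 - r) * r ^+ N)).
  by rewrite ler_wpM2l ?divr_ge0 ?(ltW r1') // gerBl exprn_ge0 // ltW.
move: hN; rewrite ltr_pdivlMr ?ltr_wpDl // => hN.
rewrite mulrAC ler_pdivrMr //; have : 0 <= r ^+ N by rewrite exprn_ge0 // ltW.
by move: hN; lra.
Qed.

Definition qpart N (a : C) : C := \prod_(0 <= j < N) (1 - a * p ^+ j).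

(** The derivative of [qpart] with respect to a, by the product rule. *)
Fixpoint dqpart N (a : C) : C :=
  if N is k.+1 then dqpart k a * (1 - a * p ^+ k) - p ^+ k * qpart k a else 0.

Lemma qpartS N a : qpart N.+1 a = qpart N a * (1 - a * p ^+ N).
Proof. by rewrite /qpart big_nat_recr. Qed.

Let geo N : R := \sum_(0 <= j < N) r ^+ j.
Let maj A N : R := \prod_(0 <= j < N) (1 + A * r ^+ j).

Let geo_ge0 N : 0 <= geo N.
Proof. by rewrite /geo sumr_ge0 // => j _; rewrite exprn_ge0 // ltW. Qed.

Let geo_le N : geo N <= (1 - r)^-1.
Proof.
rewrite -[leRHS]mul1r ler_pdivlMr //.
suff -> : geo N * (1 - r) = 1 - r ^+ N by rewrite gerBl exprn_ge0 // ltW.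
elim: N => [|N IH]; first by rewrite /geo big_geq // mul0r expr0 subrr.
by rewrite /geo big_nat_recr //= mulrDl -/(geo N) IH exprS; ring.
Qed.

Let maj_ge0 A N : 0 <= A -> 0 <= maj A N.
Proof.
by move=> A0; rewrite /maj prodr_ge0 // => j _; rewrite addr_ge0 ?mulr_ge0 ?exprn_ge0 // ltW.
Qed.

Let majS A N : maj A N.+1 = maj A N * (1 + A * r ^+ N).
Proof. by rewrite /maj big_nat_recr. Qed.

Let maj_le A N : 0 <= A -> maj A N <= expR (A / (1 - r)).
Proof.
move=> A0; apply: (@le_trans _ _ (expR (A * geo N))); last first.
  by rewrite ler_expR ler_wpM2l.
elim: N => [|N IH]; first by rewrite /maj /geo !big_geq // mulr0 expR0.
rewrite majS /geo big_nat_recr //= [A * (_ + _)]mulrDr expRD; apply: ler_pM => //.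
- exact: maj_ge0.
- by rewrite addr_ge0 ?mulr_ge0 ?exprn_ge0 // ltW.
- exact: expR_ge1Dx.
Qed.

Let factor_le (A : R) (a : C) N : modulus a <= A -> modulus (1 - a * p ^+ N) <= 1 + A * r ^+ N.
Proof.
move=> ha; apply: (le_trans (modulusD _ _)); rewrite modulus1 modulusN modulusM modulusX lerD2l.
by rewrite ler_wpM2r // exprn_ge0 // ltW.
Qed.

Let rN N : 0 <= r ^+ N. Proof. by rewrite exprn_ge0 // ltW. Qed.

Lemma qpart_le (A : R) a N : modulus a <= A -> modulus (qpart N a) <= maj A N.
Proof.
move=> ha; elim: N => [|N IH]; first by rewrite /qpart /maj !big_geq // modulus1.
by rewrite qpartS majS modulusM ler_pM ?modulus_ge0 ?factor_le.
Qed.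

Lemma qpart_lip (A : R) a b N : modulus a <= A -> modulus b <= A ->
  modulus (qpart N b - qpart N a) <= geo N * maj A N * modulus (b - a).
Proof.
move=> ha hb; have A0 : 0 <= A by apply: le_trans ha; apply: modulus_ge0.
elim: N => [|N IH].
  by rewrite /qpart /geo !big_geq // subrr modulus0 !mul0r.
rewrite !qpartS.
have -> : qpart N b * (1 - b * p ^+ N) - qpart N a * (1 - a * p ^+ N) =
  (1 - b * p ^+ N) * (qpart N b - qpart N a) - (b - a) * p ^+ N * qpart N a by ring.
apply: (le_trans (modulusD _ _)); rewrite modulusN !modulusM modulusX -/r.
apply: (@le_trans _ _ ((1 + A * r ^+ N) * (geo N * maj A N * modulus (b - a)) +
   modulus (b - a) * r ^+ N * maj A N)).
  apply: lerD; first by apply: ler_pM; rewrite ?modulus_ge0 ?factor_le.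
  by apply: ler_wpM2l; [rewrite mulr_ge0 ?modulus_ge0 | apply: qpart_le].
rewrite majS /geo big_nat_recr //= -/(geo N).
have := rN N; have := modulus_ge0 (b - a); have := maj_ge0 N A0; have := geo_ge0 N.
move: (modulus (b - a)) (r ^+ N) (maj A N) (geo N) A0 => d t m g A0 g0 m0 d0 t0.
rewrite -subr_ge0; have -> : (g + t) * (m * (1 + A * t)) * d - ((1 + A * t) * (g * m * d) + d * t * m)
  = A * t * t * m * d by ring.
by rewrite !mulr_ge0.
Qed.

Lemma dqpart_le (A : R) a N : modulus a <= A -> modulus (dqpart N a) <= geo N * maj A N.
Proof.
move=> ha; have A0 : 0 <= A by apply: le_trans ha; apply: modulus_ge0.
elim: N => [|N IH]; first by rewrite /= modulus0 mulr_ge0 ?maj_ge0.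
rewrite /=; apply: (le_trans (modulusD _ _)); rewrite modulusN !modulusM modulusX -/r.
apply: (@le_trans _ _ (geo N * maj A N * (1 + A * r ^+ N) + r ^+ N * maj A N)).
  apply: lerD; first by apply: ler_pM; rewrite ?modulus_ge0 ?factor_le.
  by apply: ler_wpM2l => //; apply: qpart_le.
rewrite majS /geo big_nat_recr //= -/(geo N).
have := rN N; have := maj_ge0 N A0; have := geo_ge0 N.
move: (r ^+ N) (maj A N) (geo N) A0 => t m g A0 g0 m0 t0.
rewrite -subr_ge0; have -> : (g + t) * (m * (1 + A * t)) - (g * m * (1 + A * t) + t * m)
  = A * t * t * m by ring.
by rewrite !mulr_ge0.
Qed.

(** The second-order remainder satisfies a recursion in N whose solution is bounded
    uniformly in N; this makes the limit of the partial products differentiable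
    without any theorem on limits of holomorphic functions. *)
Lemma qpart_taylor (A : R) a h N : modulus a <= A -> modulus (a + h) <= A ->
  modulus (qpart N (a + h) - qpart N a - dqpart N a * h) <= geo N ^+ 2 * maj A N * modulus h ^+ 2.
Proof.
move=> ha hb; have A0 : 0 <= A by apply: le_trans ha; apply: modulus_ge0.
elim: N => [|N IH].
  by rewrite /qpart /geo /= !big_geq // mul0r !subrr modulus0 expr0n /= !mul0r.
rewrite !qpartS /=.
have -> : qpart N (a + h) * (1 - (a + h) * p ^+ N) - qpart N a * (1 - a * p ^+ N) -
     (dqpart N a * (1 - a * p ^+ N) - p ^+ N * qpart N a) * h =
  (1 - a * p ^+ N) * (qpart N (a + h) - qpart N a - dqpart N a * h) -
    h * p ^+ N * (qpart N (a + h) - qpart N a) by ring.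
apply: (le_trans (modulusD _ _)); rewrite modulusN !modulusM modulusX -/r.
have lip := qpart_lip N ha hb; rewrite [a + h - a]addrAC subrr add0r in lip.
apply: (@le_trans _ _ ((1 + A * r ^+ N) * (geo N ^+ 2 * maj A N * modulus h ^+ 2) +
   modulus h * r ^+ N * (geo N * maj A N * modulus h))).
  apply: lerD; first by apply: ler_pM; rewrite ?modulus_ge0 ?factor_le.
  by apply: ler_wpM2l => //; rewrite mulr_ge0 ?modulus_ge0.
rewrite majS /geo big_nat_recr //= -/(geo N).
have := rN N; have := modulus_ge0 h; have := maj_ge0 N A0; have := geo_ge0 N.
move: (modulus h) (r ^+ N) (maj A N) (geo N) A0 => d t m g A0 g0 m0 d0 t0.
rewrite -subr_ge0; have -> : (g + t) ^+ 2 * (m * (1 + A * t)) * d ^+ 2 -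
  ((1 + A * t) * (g ^+ 2 * m * d ^+ 2) + d * t * (g * m * d))
  = (g * t + t ^+ 2 + A * t * (2 * g * t + t ^+ 2)) * m * d ^+ 2 by ring.
by rewrite !(mulr_ge0, addr_ge0) ?sqr_ge0.
Qed.

Lemma qpoch_tends a : tends (fun N => qpart N a) (qpoch p a).
Proof.
suff [l hl] : exists l, tends (fun N => qpart N a) l.
  by rewrite /qpoch (tends_lim hl).
apply: (@geometric_cauchy _ (modulus a * expR (modulus a / (1 - r)))) => n.
rewrite qpartS; have -> : qpart n a * (1 - a * p ^+ n) - qpart n a = - (a * (qpart n a) * p ^+ n) by ring.
rewrite modulusN !modulusM modulusX -/r ler_wpM2r // ler_wpM2l ?modulus_ge0 //.
apply: (le_trans (qpart_le n (lexx _))); exact/maj_le/modulus_ge0.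
Qed.

Lemma qpoch_deriv a : exists d, has_deriv (qpoch p) a d.
Proof.
pose A := modulus a + 1.
have ha : modulus a <= A by rewrite lerDl.
have A0 : 0 <= A by apply: le_trans ha; apply: modulus_ge0.
pose M := expR (A / (1 - r)).
have M0 : 0 <= M by apply: expR_ge0.
pose S := (1 - r)^-1; have S0 : 0 <= S by rewrite invr_ge0 ltW.
have [d hd] : exists d, tends (fun N => dqpart N a) d.
  apply: (@geometric_cauchy _ (A * (S * M) + M)) => n /=.
  have -> : dqpart n a * (1 - a * p ^+ n) - p ^+ n * qpart n a - dqpart n a =
    - ((a * dqpart n a + qpart n a) * p ^+ n) by ring.
  rewrite modulusN modulusM modulusX -/r ler_wpM2r //.
  apply: (le_trans (modulusD _ _)); rewrite modulusM; apply: lerD.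
    apply: ler_pM; rewrite ?modulus_ge0 //; apply: (le_trans (dqpart_le n ha)).
    by apply: ler_pM; [apply: geo_ge0 | apply: maj_ge0 | apply: geo_le | apply: maj_le].
  by apply: (le_trans (qpart_le n ha)); apply: maj_le.
have T h : modulus h < 1 -> modulus (qpoch p (a + h) - qpoch p a - d * h) <= S ^+ 2 * M * modulus h ^+ 2.
  move=> h1; have hb : modulus (a + h) <= A.
    by apply: (le_trans (modulusD _ _)); rewrite lerD2l ltW.
  have lim : tends (fun N => qpart N (a + h) + -1 * qpart N a + (- h) * dqpart N a)
               (qpoch p (a + h) + -1 * qpoch p a + (- h) * d).
    by apply: tendsD; [apply: tendsD; [|apply: tendsZ]; apply: qpoch_tends | apply: tendsZ].
  have -> : qpoch p (a + h) - qpoch p a - d * h = qpoch p (a + h) + -1 * qpoch p a + (- h) * d - 0 by ring.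
  apply: (tends_mod_le (N := 0)) lim => n _.
  have -> : qpart n (a + h) + -1 * qpart n a + (- h) * dqpart n a - 0 =
     qpart n (a + h) - qpart n a - dqpart n a * h by ring.
  apply: (le_trans (qpart_taylor n ha hb)); rewrite ler_wpM2r ?sqr_ge0 //.
  apply: ler_pM; rewrite ?sqr_ge0 ?maj_ge0 ?maj_le //.
  by rewrite lerXn2r ?nnegrE ?geo_ge0 ?geo_le.
exists d => e e0; pose K := S ^+ 2 * M + 1.
have K0 : 0 < K by rewrite ltr_wpDl // mulr_ge0 ?sqr_ge0.
exists (Num.min 1 (e / K)); first by rewrite lt_min ltr01 divr_gt0.
move=> h; rewrite lt_min => /andP[h1]; rewrite ltr_pdivlMr // => h2.
apply: (le_trans (T h h1)); rewrite expr2 mulrA ler_wpM2r ?modulus_ge0 //.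
have m0 := modulus_ge0 h.
by apply: le_trans (ltW h2); rewrite mulrC ler_wpM2l // lerDl.
Qed.

Lemma qpochS a : qpoch p a = (1 - a) * qpoch p (p * a).
Proof.
apply: tends_unique (tendsS (qpoch_tends a)) _.
apply: tends_ext (tendsZ (1 - a) (qpoch_tends (p * a))) => N.
rewrite /qpart big_nat_recl // expr0 mulr1; congr (_ * _).
by apply: eq_bigr => j _; rewrite exprS mulrA (mulrC a).
Qed.

Lemma qpoch0 : qpoch p 0 = 1.
Proof.
apply: tends_unique (qpoch_tends 0) _; apply: tends_ext (tends_cst 1) => N.
by rewrite /qpart big1 // => j _; rewrite mul0r subr0.
Qed.

Lemma qpoch_shift J a : qpoch p a = qpart J a * qpoch p (p ^+ J * a).
Proof.
elim: J => [|J IH]; first by rewrite /qpart big_geq // !mul1r.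
rewrite IH qpartS (qpochS (p ^+ J * a)) exprS !mulrA; congr (_ * _ * qpoch _ _).
by rewrite (mulrC a).
Qed.

(** Peel off factors until the argument is so small that the remaining product is
    close to its value 1 at the origin; then one of the peeled factors vanishes. *)
Lemma qpoch_eq0 a : qpoch p a = 0 -> exists j, a * p ^+ j = 1.
Proof.
move=> h.
have [d /has_deriv_cont/(_ (1 / 2))] := qpoch_deriv 0; rewrite qpoch0.
move=> [|s s0 hs]; first by rewrite divr_gt0.
have [J hJ] : exists J, r ^+ J < s / (modulus a + 1).
  have [||m] := @pow_gap R r 1 (s / (modulus a + 1)); first by rewrite (ltW r0).
    by rewrite divr_gt0 // ltr_wpDl ?modulus_ge0.
  by rewrite expr1n mulr1; exists m.
have hq : qpoch p (p ^+ J * a) != 0.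
  apply/eqP => h0; have := hs (p ^+ J * a); rewrite add0r h0 sub0r modulusN modulus1.
  suff hh : modulus (p ^+ J * a) < s by move=> /(_ hh); lra.
  rewrite modulusM modulusX -/r; move: hJ; rewrite ltr_pdivlMr ?ltr_wpDl ?modulus_ge0 //.
  by apply: le_lt_trans; rewrite ler_wpM2l // lerDl.
move: h; rewrite (qpoch_shift J) => /eqP; rewrite mulf_eq0 (negbTE hq) orbF /qpart.
rewrite prodf_seq_eq0 => /hasP[j _ /=]; rewrite subr_eq0 => /eqP e.
by exists j.
Qed.

Lemma qpoch_holo : holo (qpoch p).
Proof. by move=> z _; have [d] := qpoch_deriv z; apply: has_derivable. Qed.

Lemma theta_holo : holo (theta p).
Proof.
apply: holoM; first exact: qpoch_holo.
apply: holo_comp; first exact: qpoch_holo.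
  by apply: holoM; [apply: holo_cst | apply: holoV => //; apply: holo_id].
by move=> z z0; rewrite mulf_neq0 ?invr_eq0 ?p_neq0.
Qed.

Lemma thetaV x : x != 0 -> theta p x^-1 = - x^-1 * theta p x.
Proof.
move=> x0; rewrite /theta invrK (qpochS x) (qpochS x^-1) mulrA.
by field.
Qed.

Lemma theta_p x : x != 0 -> theta p (p * x) = - x^-1 * theta p x.
Proof.
move=> x0; rewrite -thetaV // /theta invrK mulrC; congr (qpoch _ _ * _).
by have p0 := p_neq0; field; rewrite x0.
Qed.

Lemma theta1 : theta p 1 = 0.
Proof. by rewrite /theta qpochS subrr !mul0r. Qed.

Lemma theta_eq0 x : x != 0 -> theta p x = 0 -> exists k : int, x = p ^ k.
Proof.
move=> x0 /eqP; rewrite /theta mulf_eq0 => /orP[] /eqP /qpoch_eq0[j hj].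
  exists (- j%:Z); rewrite -invr_expz -exprnP; apply: (mulIf (expf_neq0 j p_neq0)).
  by rewrite hj mulVf // expf_neq0 // p_neq0.
exists (j.+1); rewrite -exprnP exprS; apply: (mulIf (invr_neq0 x0)).
by rewrite mulfV // -hj; ring.
Qed.

Lemma modulus_exprz (k : int) : modulus (p ^ k) = r ^ k.
Proof. by case: k => n; rewrite /exprz ?modulusV modulusX. Qed.

(** In an interval ]al, be[ with be <= al / |p|, each b > 0 excludes at most one t,
    because two quotients t b that are powers of |p| differ by a factor at least
    1 / |p|.  So one half of the interval is free of the value excluded by b. *)
Lemma generic_modulus (s : seq R) (al be : R) : 0 < al -> al < be -> be <= al / r ->
  exists2 t, al < t < be & forall b, b \in s -> 0 < b -> forall k : int, t * b != r ^ k.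
Proof.
elim: s al be => [|b s IH] al be a0 ab bm.
  by exists ((al + be) / 2) => //; apply/andP; split; lra.
pose m := (al + be) / 2.
have am : al < m by rewrite /m; lra.
have mb : m < be by rewrite /m; lra.
have arm : al / r <= m / r by rewrite ler_pM2r ?invr_gt0 // ltW.
have [[k [t [ht hk b0]]]|H] := pselect (exists k : int, exists t, [/\ al < t < m, t * b = r ^ k & 0 < b]).
  have [t' /andP[t1 t2] h'] := IH m be (lt_trans a0 am) mb (le_trans bm arm).
  exists t'; first by rewrite (lt_trans am t1) t2.
  move=> b'; rewrite inE => /orP[/eqP -> _ k'|]; last exact: h'.
  apply/eqP => hk'.
  have [/andP[ta tm]] := ht.
  have t0 : 0 < t by apply: lt_trans ta.
  have tt' : t' / t = r ^ (k' - k).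
    by rewrite expfzDr ?gt_eqF // -invr_expz -hk -hk'; field; rewrite !gt_eqF.
  have big : 1 < r ^ (k' - k) by rewrite -tt' ltr_pdivlMr // mul1r; apply: lt_trans tm t1.
  have sml : r ^ (k' - k) < r^-1.
    rewrite -tt' ltr_pdivrMr //; apply: (lt_le_trans t2); apply: (le_trans bm).
    by rewrite mulrC ler_pM2l ?invr_gt0 // ltW.
  case: (k' - k) big sml => n; rewrite /exprz.
    by rewrite ltNge exprn_ile1 // ltW.
  move=> _; rewrite ltf_pV2 ?posrE ?exprn_gt0 // => h2.
  by move: h2; rewrite exprS ltNge ler_piMr ?exprn_ile1 // ltW.
have [t /andP[t1 t2] h'] := IH al m a0 am (le_trans (ltW mb) bm).
exists t; first by rewrite t1 (lt_trans t2 mb).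
move=> b'; rewrite inE => /orP[/eqP -> b0 k|]; last exact: h'.
by apply/eqP => hk; apply: H; exists k, t; rewrite t1 t2.
Qed.

(** Used to move interpolation nodes into general position. *)
Lemma generic_point (s : seq C) : exists2 t : C, t != 0 &
  forall b, b \in s -> b != 0 -> theta p (t * b) != 0.
Proof.
have [||t /andP[t1 _] h] := @generic_modulus [seq modulus b | b <- s] 1 r^-1 ltr01.
- by rewrite invf_gt1.
- by rewrite div1r.
have t0 : 0 < t by apply: lt_trans t1.
exists (ofR t); first by rewrite -modulus_gt0 ofR_mod // ltW.
move=> b bs b0; apply/eqP => /theta_eq0[].
  by rewrite mulf_neq0 // -modulus_gt0 ofR_mod // ltW.
move=> k hk; have := h (modulus b) (map_f _ bs); rewrite modulus_gt0 => /(_ b0 k)/eqP; apply.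
by rewrite -modulus_exprz -hk modulusM ofR_mod // ltW.
Qed.

End Pochhammer.

(** * Laurent coefficients of quasi-periodic functions *)

Section LaurentCoefficients.
Variable R : realType.
Local Notation C := (Cplx R).
Implicit Types (f g : C -> C).

(** The coefficient of z^-k in the Laurent expansion of f. *)
Definition lcoef f (k : int) : C :=
  (lim ((fun N => circle_mean N (fun w => f w * w ^ k) 1%R) @ \oo))%classic.

Lemma lcoefP f k z : holo f -> z != 0 ->
  tends (fun N => circle_mean N (fun w => f w * w ^ k) z) (lcoef f k).
Proof.
move=> hf z0; have [l hl] := circle_mean_tends (holoM hf (holo_exprz (k := k))).
have -> : lcoef f k = l by apply: tends_lim; apply: hl; rewrite oner_neq0.
exact: hl.
Qed.

Lemma lcoef_eq0 f : holo f -> (forall k, lcoef f k = 0) -> forall z, z != 0 -> f z = 0.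
Proof. by move=> hf h; apply: laurent_unique => // k z z0; rewrite -(h k); apply: lcoefP. Qed.

Lemma lcoef_lin n (v : 'I_n -> C) (F : 'I_n -> C -> C) k : (forall i, holo (F i)) ->
  lcoef (fun z => \sum_i v i * F i z) k = \sum_i v i * lcoef (F i) k.
Proof.
move=> hF; apply: tends_unique (lcoefP k _ (oner_neq0 _)) _.
  by apply: holo_sum => i _; apply: holoM (hF i); apply: holo_cst.
have T : tends (fun N => \sum_i v i * circle_mean N (fun w => F i w * w ^ k) 1) (\sum_i v i * lcoef (F i) k).
  by apply: tends_sum => i; apply: tendsZ; apply: lcoefP; rewrite ?oner_neq0.
apply: tends_ext T => N; rewrite /circle_mean.
under eq_bigr do rewrite mulrCA mulr_sumr.
rewrite -mulr_sumr exchange_big; congr (_ * _); apply: eq_bigr => j _ /=.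
by rewrite mulr_suml; apply: eq_bigr => i _; rewrite mulrA.
Qed.

(** The inversion permutes the dyadic roots of unity. *)
Lemma lcoef_sym f k : holo f -> (forall z, z != 0 -> f z^-1 = f z) -> lcoef f (- k) = lcoef f k.
Proof.
move=> hf sym; apply: tends_unique (lcoefP (- k) hf (oner_neq0 _)) _.
apply: tends_ext (lcoefP k hf (oner_neq0 _)) => N; rewrite /circle_mean; congr (_ * _).
set w := dyadic_root R N; have w0 : w != 0 by apply: dyadic_root_neq0.
have wM : w ^+ (2 ^ N) = 1 by apply: dyadic_root_pow.
move: (2 ^ N)%N wM => M wM.
pose h (z : C) := f z * z ^ (- k).
have hV j : f (1 * w ^+ j) * (1 * w ^+ j) ^ k = h (w ^- j).
  by rewrite mul1r /h sym ?expf_neq0 // exprz_inv opprK.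
under eq_bigr do rewrite hV.
under [in RHS]eq_bigr do rewrite mul1r -/(h _).
move: h {hV} => h.
pose H j := h (w ^+ (M - j)).
have H0 : H 0%N = h 1 by rewrite /H subn0 wM.
have HM : H M = h 1 by rewrite /H subnn.
rewrite -(big_mkord predT (fun j => h (w ^- j))) -(big_mkord predT (fun j => h (w ^+ j))).
rewrite [RHS]big_nat_rev /= add0n.
transitivity (\sum_(0 <= j < M) H j).
  rewrite big_nat [RHS]big_nat; apply: eq_bigr => j /andP[_ hj]; rewrite /H; congr h.
  by rewrite -[LHS]mul1r -wM -(subnK (ltnW hj)) addnK exprD mulfK ?expf_neq0.
have : H 0%N + \sum_(0 <= j < M) H j.+1 = \sum_(0 <= j < M) H j + H M.
  by rewrite -big_nat_recr // -big_nat_recl.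
by rewrite H0 HM addrC => /addIr <-.
Qed.

Section QuasiPeriodic.
Variables (p : C) (hp : 0 < `|p| < 1).

(** Compare the means over the circles through 1 and through p. *)
Lemma lcoef_shift f m (K : C) k : holo f -> (forall x, x != 0 -> f (p * x) = K / x ^+ m * f x) ->
  lcoef f k = K * p ^ k * lcoef f (k - m%:Z).
Proof.
move=> hf qp; have p0 := p_neq0 hp.
apply: tends_unique (lcoefP k hf p0) _.
apply: tends_ext (tendsZ (K * p ^ k) (lcoefP (k - m%:Z) hf (oner_neq0 _))) => N.
rewrite /circle_mean mulrCA; congr (_ * _); rewrite mulr_sumr; apply: eq_bigr => j _.
have w0 : dyadic_root R N ^+ j != 0 by rewrite expf_neq0 // dyadic_root_neq0.
by rewrite mul1r qp // exprzMl ?unitfE // expfzDr // -invr_expz -exprnP; ring.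
Qed.

(** By [lcoef_shift], m consecutive Laurent coefficients determine the others.
    Hence quasi-periodic functions of degree m form a space of dimension at most m. *)
Lemma lcoef_window f m (K : C) (k0 : int) : (0 < m)%N -> K != 0 -> holo f ->
  (forall x, x != 0 -> f (p * x) = K / x ^+ m * f x) ->
  (forall j, (j < m)%N -> lcoef f (k0 + j%:Z) = 0) -> forall z, z != 0 -> f z = 0.
Proof.
move=> m0 K0 hf qp h; apply: lcoef_eq0 => // k.
have sh := lcoef_shift _ hf qp.
have up (j : nat) : lcoef f (k0 + j%:Z) = 0.
  elim/ltn_ind: j => j IH; have [/h //|hj] := ltnP j m.
  rewrite sh; have -> : k0 + j%:Z - m%:Z = k0 + (j - m)%N%:Z by lia.
  by rewrite IH ?mulr0 //; lia.
have down (j : nat) : lcoef f (k0 - j%:Z) = 0.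
  elim/ltn_ind: j => j IH; have [->|j0] := posnP j; first by rewrite subr0 -[k0]addr0 up.
  have H : lcoef f (k0 - j%:Z + m%:Z) = 0.
    have [hj|hj] := leqP j m; first by have -> : k0 - j%:Z + m%:Z = k0 + (m - j)%N%:Z by lia.
    have -> : k0 - j%:Z + m%:Z = k0 - (j - m)%N%:Z by lia.
    by apply: IH; lia.
  move: (sh (k0 - j%:Z + m%:Z)); rewrite H addrK => /esym/eqP.
  by rewrite !mulf_eq0 (negbTE K0) expfz_eq0 (negbTE (p_neq0 hp)) andbF => /eqP.
have -> : k = k0 + (k - k0) by ring.
by case: (k - k0) => j; rewrite ?NegzE ?up ?down.
Qed.

End QuasiPeriodic.

(** The functions L i and f are m + 1 elements of a space on which m functionals are
    jointly injective, hence linearly dependent; evaluating a relation at the nodes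
    y i kills the coefficients of the L i and leaves a multiple of f. *)
Lemma unisolvent (V : (C -> C) -> Prop) m (k : 'I_m -> int) (y : 'I_m -> C) (L : 'I_m -> C -> C) f :
  (forall g, V g -> holo g) ->
  (forall n (v : 'I_n -> C) (F : 'I_n -> C -> C), (forall i, V (F i)) -> V (fun z => \sum_i v i * F i z)) ->
  (forall g, V g -> (forall i, lcoef g (k i) = 0) -> forall z, z != 0 -> g z = 0) ->
  (forall i, y i != 0) -> (forall i, V (L i)) ->
  (forall i j, i != j -> L i (y j) = 0) -> (forall i, L i (y i) != 0) ->
  V f -> (forall i, f (y i) = 0) -> forall z, z != 0 -> f z = 0.
Proof.
move=> Vh Vlin Vinj y0 VL L0 L1 Vf fy z z0.
pose F (i : 'I_m.+1) := oapp L f (unlift ord0 i).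
have F0 : F ord0 = f by rewrite /F unlift_none.
have FS i : F (lift ord0 i) = L i by rewrite /F liftK.
have VF i : V (F i) by rewrite /F; case: unlift.
pose A : 'M[C]_(m.+1, m) := \matrix_(i, j) lcoef (F i) (k j).
have : kermx A != 0.
  by rewrite -mxrank_eq0 mxrank_ker -lt0n subn_gt0 ltnS rank_leq_col.
move=> /rowV0Pn[v /sub_kermxP vA vn].
pose g z := \sum_i v 0 i * F i z.
have g0 : forall z, z != 0 -> g z = 0.
  apply: Vinj; first exact: Vlin.
  move=> j; rewrite lcoef_lin; last by move=> i; apply: Vh.
  by move/rowP: vA => /(_ j); rewrite !mxE => e; rewrite -[RHS]e; apply: eq_bigr => i _; rewrite mxE.
have vS i : v 0 (lift ord0 i) = 0.
  have := g0 _ (y0 i); rewrite /g big_ord_recl F0 fy mulr0 add0r (bigD1 i) //= big1.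
    by rewrite addr0 FS => /eqP; rewrite mulf_eq0 (negbTE (L1 i)) orbF => /eqP.
  by move=> j ji; rewrite FS L0 ?mulr0.
have v00 : v 0 ord0 != 0.
  apply: contra vn => /eqP h; apply/eqP/rowP => i; rewrite mxE.
  by case: (unliftP ord0 i) => [j|] ->.
have := g0 z z0; rewrite /g big_ord_recl F0 big1 ?addr0.
  by move=> /eqP; rewrite mulf_eq0 (negbTE v00) => /eqP.
by move=> i _; rewrite vS mul0r.
Qed.

End LaurentCoefficients.

(** * Interpolation in spaces of theta functions *)

Section ThetaSpaces.
Variable R : realType.
Local Notation C := (Cplx R).
Variables (p : C) (hp : 0 < `|p| < 1).
Implicit Types (f : C -> C).

(** The A_(m-1) theta functions of norm s, as a space: the conditions of [A_theta]
    without those on m and s. *)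
Definition spaceA m (s : C) f := holo f /\
  forall x, x != 0 -> f (p * x) = (-1) ^+ m / (s * x ^+ m) * f x.

(** Functions with the quasi-periodicity and inversion symmetry, in each variable,
    of the product over i < j of x_i^-1 theta (x_i x_j^+-) in m + 1 variables. *)
Definition spaceD m f := [/\ holo f,
  forall x, x != 0 -> f (p * x) = (p * x ^+ 2) ^- m * f x &
  forall x, x != 0 -> f x^-1 = f x].

Lemma spaceA_lin m s n (v : 'I_n -> C) (F : 'I_n -> C -> C) :
  (forall i, spaceA m s (F i)) -> spaceA m s (fun z => \sum_i v i * F i z).
Proof.
move=> h; split=> [|x x0].
  by apply: holo_sum => i _; apply: holoM (h i).1; apply: holo_cst.
by rewrite mulr_sumr; apply: eq_bigr => i _; rewrite (h i).2 // mulrCA.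
Qed.

Lemma spaceD_lin m n (v : 'I_n -> C) (F : 'I_n -> C -> C) :
  (forall i, spaceD m (F i)) -> spaceD m (fun z => \sum_i v i * F i z).
Proof.
move=> h; split=> [|x x0|x x0].
- by apply: holo_sum => i _; have [hh _ _] := h i; apply: holoM hh; apply: holo_cst.
- by rewrite mulr_sumr; apply: eq_bigr => i _; have [_ -> //] := h i; rewrite mulrCA.
- by apply: eq_bigr => i _; have [_ _ ->] := h i.
Qed.

Lemma holo_theta_lin (a : C) : a != 0 -> holo (fun x => theta p (x * a)).
Proof.
move=> a0; apply: (holo_comp (theta_holo hp)); first by apply: holoM; [apply: holo_id | apply: holo_cst].
by move=> z z0; rewrite mulf_neq0.
Qed.

(** The extra theta factor adjusts the norm to s. *)
Lemma spaceA_lagrange m (s : C) (y : 'I_m -> C) i : s != 0 -> (forall i, y i != 0) ->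
  spaceA m s (fun x => theta p (x * (s * \prod_(k | k != i) y k)) *
                       \prod_(k | k != i) theta p (x / y k)).
Proof.
move=> s0 y0; have m0 : (0 < m)%N by apply: leq_ltn_trans (ltn_ord i).
have q0 : \prod_(k | k != i) y k != 0 by apply/prodf_neq0 => k _; apply: y0.
pose b := s * \prod_(k | k != i) y k.
have b0 : b != 0 by rewrite mulf_neq0.
rewrite -/b.
split.
    apply: holoM; first exact: holo_theta_lin.
    by apply: holo_prod => k _; apply: holo_theta_lin; rewrite invr_eq0.
  move=> x x0; rewrite -mulrA theta_p ?mulf_neq0 //.
  rewrite (eq_bigr (fun k => - (x / y k)^-1 * theta p (x / y k))); last first.
    by move=> k _; rewrite -mulrA theta_p // mulf_neq0 ?invr_eq0.
  rewrite big_split /=.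
  have -> : \prod_(k | k != i) - (x / y k)^-1 = (-1) ^+ m.-1 / x ^+ m.-1 * \prod_(k | k != i) y k.
    have -> : m.-1 = #|[pred k | k != i]| by rewrite cardC1 card_ord.
    rewrite -!prodr_const -prodfV -!big_split /=.
    by apply: eq_bigr => k _; field; rewrite x0 y0.
  have em (z : C) : z ^+ m = z * z ^+ m.-1 by rewrite -exprS prednK.
  rewrite !em /b.
  by field; rewrite s0 x0 q0 expf_neq0.
Qed.

(** The functions of [spaceA_lagrange] form a Lagrange basis at the nodes y; the condition on
    the product of the nodes says that the extra theta factor does not vanish. *)
Lemma spaceA_unisolvent m (s : C) (y : 'I_m -> C) f :
  (0 < m)%N -> s != 0 -> (forall i, y i != 0) ->
  (forall i j, i != j -> theta p (y i / y j) != 0) -> theta p (s * \prod_i y i) != 0 ->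
  spaceA m s f -> (forall i, f (y i) = 0) -> forall z, z != 0 -> f z = 0.
Proof.
move=> m0 s0 y0 yd ys hf.
pose b i := s * \prod_(k | k != i) y k.
have q0 i : \prod_(k | k != i) y k != 0 by apply/prodf_neq0 => k _; apply: y0.
have b0 i : b i != 0 by rewrite mulf_neq0.
pose L i x := theta p (x * b i) * \prod_(k | k != i) theta p (x / y k).
have pm0 : (-1 : C) ^+ m != 0 by rewrite signr_eq0.
apply: (@unisolvent _ (spaceA m s) m (fun i => 0 + i%:Z) y L f) => //.
- by move=> g [].
- by move=> n v F; apply: spaceA_lin.
- move=> g [hg qg] h; apply: (@lcoef_window _ p hp g m ((-1) ^+ m / s) 0) => //.
    by rewrite mulf_neq0 ?invr_eq0.
    by move=> x x0; rewrite qg // invfM mulrA.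
  by move=> j hj; apply: (h (Ordinal hj)).
- by move=> i; apply: spaceA_lagrange.
- move=> i j ij; rewrite /L (bigD1 j) 1?eq_sym //= divff //.
  by rewrite (theta1 hp) !(mul0r, mulr0).
- move=> i; rewrite /L mulf_neq0 //.
    by move: ys; rewrite (bigD1 i) //= mulrCA.
  by apply/prodf_neq0 => k ki; rewrite yd // eq_sym.
Qed.

Definition psiD (x y : C) := x^-1 * theta_pm p x y.

Lemma psiD_p x y : x != 0 -> y != 0 -> psiD (p * x) y = (p * x ^+ 2)^-1 * psiD x y.
Proof.
move=> x0 y0; have p0 := p_neq0 hp; rewrite /psiD /theta_pm.
have -> : p * x * y = p * (x * y) by ring.
have -> : p * x / y = p * (x / y) by ring.
rewrite !theta_p ?mulf_neq0 ?invr_eq0 //.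
by field; rewrite p0 x0 y0.
Qed.

Lemma psiD_V x y : x != 0 -> y != 0 -> psiD x^-1 y = psiD x y.
Proof.
move=> x0 y0; rewrite /psiD /theta_pm.
have -> : x^-1 * y = (x / y)^-1 by rewrite invf_div mulrC.
have -> : x^-1 / y = (x * y)^-1 by rewrite invfM.
by rewrite !(thetaV hp) ?mulf_neq0 ?invr_eq0 //; field; rewrite x0 y0.
Qed.

Lemma psiD_holo y : y != 0 -> holo (psiD^~ y).
Proof.
move=> y0; apply: holoM; first by apply: holoV => //; apply: holo_id.
by apply: holoM; apply: holo_theta_lin; rewrite ?invr_eq0.
Qed.

Lemma spaceD_prod n (Q : pred 'I_n) (y : 'I_n -> C) : (forall i, y i != 0) ->
  spaceD #|Q| (fun x => \prod_(k | Q k) psiD x (y k)).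
Proof.
move=> y0; split=> [|x x0|x x0].
- by apply: holo_prod => k _; apply: psiD_holo.
- rewrite (eq_bigr (fun k => (p * x ^+ 2)^-1 * psiD x (y k))); last by move=> k _; rewrite psiD_p.
  by rewrite big_split /= prodr_const exprVn.
- by apply: eq_bigr => k _; rewrite psiD_V.
Qed.

(** By the symmetry f (1/z) = f z the Laurent coefficients 0, ..., m determine those
    between -m and m, which contain 2 m consecutive ones. *)
Lemma spaceD_unisolvent m (y : 'I_m.+1 -> C) f : (0 < m)%N -> (forall i, y i != 0) ->
  (forall i j, i != j -> theta_pm p (y i) (y j) != 0) ->
  spaceD m f -> (forall i, f (y i) = 0) -> forall z, z != 0 -> f z = 0.
Proof.
move=> m0 y0 yd hf.
pose L i x := \prod_(k | k != i) psiD x (y k).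
apply: (@unisolvent _ (spaceD m) m.+1 (fun i => i%:Z) y L f) => //.
- by move=> g [].
- by move=> n v F; apply: spaceD_lin.
- move=> g [hg qg sg] h; apply: (@lcoef_window _ p hp g (2 * m) (p ^- m) (1 - m%:Z)) => //.
  + by rewrite muln_gt0.
  + by rewrite invr_eq0 expf_neq0 // p_neq0.
  + by move=> x x0; rewrite qg // exprMn invfM -exprM.
  + move=> j hj.
    suff H (k : int) : (`|k| <= m)%N -> lcoef g k = 0 by apply: H; lia.
    case: k => k hk; first by apply: (h (Ordinal (hk : (k < m.+1)%N))).
    by rewrite NegzE lcoef_sym //; apply: (h (Ordinal (hk : (k.+1 < m.+1)%N))).
- move=> i; have := spaceD_prod [pred k | k != i] y0.
  by rewrite cardC1 card_ord.
- move=> i j ij; rewrite /L (bigD1 j) 1?eq_sym //= /psiD /theta_pm divff //.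
  by rewrite (theta1 hp) !(mul0r, mulr0).
- move=> i; apply/prodf_neq0 => k ki; rewrite /psiD; apply: mulf_neq0; first by rewrite invr_eq0.
  by apply: yd; rewrite eq_sym.
Qed.

End ThetaSpaces.

(** * Interpolation in several variables and products over pairs *)

Section Interpolation.
Variable R : realType.
Local Notation C := (Cplx R).

Definition upd n (x : 'I_n -> C) (i : 'I_n) (z : C) : 'I_n -> C :=
  fun j => if j == i then z else x j.

Lemma updE n (x : 'I_n -> C) i z : upd x i z i = z.
Proof. by rewrite /upd eqxx. Qed.

Lemma updN n (x : 'I_n -> C) i z j : j != i -> upd x i z j = x j.
Proof. by rewrite /upd => /negbTE ->. Qed.

Lemma upd_id n (x : 'I_n -> C) i : upd x i (x i) = x.
Proof. by apply/funext => j; rewrite /upd; case: eqP => [->|]. Qed.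

Lemma upd_neq0 n (x : 'I_n -> C) i z : (forall j, x j != 0) -> z != 0 -> forall j, upd x i z j != 0.
Proof. by move=> h z0 j; rewrite /upd; case: ifP. Qed.

Lemma prod_upd n (x : 'I_n -> C) i z : \prod_k upd x i z k = z * \prod_(k | k != i) x k.
Proof.
by rewrite (bigD1 i) //= updE; congr (_ * _); apply: eq_bigr => k ki; rewrite updN.
Qed.

(** The induction principle behind both determinant evaluations.  D x is the
    difference of the two sides of an identity; it lies in V as a function of each
    variable, vanishes when two variables are equivalent, and vanishes when the
    last variable is b.  If x_1, ..., x_n and b are inequivalent nodes, then D
    vanishes as a function of the last variable.  At most one x_i with i <= n is
    equivalent to b; such an x_i is first replaced by a generic t, and
    then D vanishes as a function of its i-th variable, with nodes t and the other x_k.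
    The predicate G collects the further conditions under which nodes determine an
    element of V. *)
Lemma vanish_by_interpolation n (V : (C -> C) -> Prop) (eqv : C -> C -> bool)
    (G : ('I_n.+1 -> C) -> bool) (D : ('I_n.+1 -> C) -> C) (b : C) :
  b != 0 ->
  (forall u v, u != 0 -> v != 0 -> eqv u v = eqv v u) ->
  (forall u, u != 0 -> eqv u u) ->
  (forall u v w, u != 0 -> v != 0 -> w != 0 -> eqv u v -> eqv v w -> eqv u w) ->
  (forall x i, (forall k, x k != 0) -> V (fun z => D (upd x i z))) ->
  (forall x i j, (forall k, x k != 0) -> i != j -> eqv (x i) (x j) -> D x = 0) ->
  (forall y f, (forall k, y k != 0) -> (forall i j, i != j -> ~~ eqv (y i) (y j)) -> G y ->
     V f -> (forall i, f (y i) = 0) -> forall z, z != 0 -> f z = 0) ->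
  (forall x, (forall k, x k != 0) -> x ord_max = b -> D x = 0) ->
  (forall x i, (forall k, x k != 0) -> i != ord_max -> exists t, [/\ t != 0,
     forall k, ~~ eqv t (x k), ~~ eqv t b, G (upd x i t) & G (upd (upd x i t) ord_max b)]) ->
  (n = 0 -> forall x, (forall k, x k != 0) -> G (upd x ord_max b)) ->
  forall x, (forall k, x k != 0) -> D x = 0.
Proof.
move=> b0 eqv_sym eqv_refl eqv_trans VD Deqv uni Dlast gen gen0 x x0.
have [/existsP[i /existsP[j /andP[ij eij]]]|/existsPn nx] := boolP [exists i, exists j, (i != j) && eqv (x i) (x j)].
  exact: Deqv ij eij.
have {}nx i j : i != j -> ~~ eqv (x i) (x j).
  by move=> ij; have /existsPn/(_ j) := nx i; rewrite ij.
(* the case where the nodes y_k and b are in general position *)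
have last (y : 'I_n.+1 -> C) : (forall k, y k != 0) ->
    (forall i j, i != j -> ~~ eqv (y i) (y j)) ->
    (forall i, i != ord_max -> ~~ eqv (y i) b) -> G (upd y ord_max b) -> D y = 0.
  move=> y0 ny yb Gy; rewrite -(upd_id y ord_max).
  apply: (uni (upd y ord_max b) (fun z => D (upd y ord_max z))) => //.
  - exact: upd_neq0.
  - move=> i j ij; rewrite /upd; case: (eqVneq i ord_max) => [ie|ie]; case: (eqVneq j ord_max) => [je|je].
    + by move: ij; rewrite ie je eqxx.
    + by rewrite eqv_sym // yb.
    + exact: yb.
    + exact: ny.
  - exact: VD.
  - move=> i; have [ie|ie] := eqVneq i ord_max.
      by rewrite ie updE; apply: Dlast; rewrite ?updE //; apply: upd_neq0.
    rewrite updN //; apply: (Deqv _ i ord_max) => //; first exact: upd_neq0.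
    by rewrite updE updN // eqv_refl.
have [n0|n_gt0] := posnP n.
  apply: last => //; last exact: gen0.
  move=> i; suff -> : i = ord_max by rewrite eqxx.
  by apply: val_inj; case: i => i /=; rewrite n0 ltnS leqn0 => /eqP.
(* after removal of x_i, no variable but the last can be equivalent to b *)
have [i im hi] : exists2 i : 'I_n.+1, i != ord_max &
    forall k, k != ord_max -> k != i -> ~~ eqv (x k) b.
  have [/existsP[i /andP[im ei]]|/existsPn H] := boolP [exists i : 'I_n.+1, (i != ord_max) && eqv (x i) b].
    exists i => // k km ki; apply/negP => ek.
    have := nx _ _ ki; rewrite (eqv_trans _ b) //.
    by rewrite eqv_sym.
  exists ord0; first by rewrite -val_eqE /= eq_sym -lt0n.
  by move=> k km _; have := H k; rewrite km.
have [t [t0 tx tb G1 G2]] := gen x i x0 im.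
rewrite -(upd_id x i).
apply: (uni (upd x i t) (fun z => D (upd x i z))) => //.
- exact: upd_neq0.
- move=> k l kl; rewrite /upd; case: (eqVneq k i) => [ke|ke]; case: (eqVneq l i) => [le|le].
  + by move: kl; rewrite ke le eqxx.
  + exact: tx.
  + by rewrite eqv_sym.
  + exact: nx.
- exact: VD.
move=> k; have [->|ki] := eqVneq k i; last first.
  rewrite updN //; apply: (Deqv _ k i) => //; first exact: upd_neq0.
  by rewrite updE updN // eqv_refl.
rewrite updE; apply: last => //; first exact: upd_neq0.
- move=> l m lm; rewrite /upd; case: (eqVneq l i) => [le|le]; case: (eqVneq m i) => [me|me].
  + by move: lm; rewrite le me eqxx.
  + exact: tx.
  + by rewrite eqv_sym.
  + exact: nx.
- move=> l lm; have [->|li] := eqVneq l i; first by rewrite updE.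
  by rewrite updN // hi.
Qed.

Definition pairprod n (psi : C -> C -> C) (x : 'I_n -> C) : C :=
  \prod_(i < n) \prod_(j < n | (i < j)%N) psi (x i) (x j).

Lemma pairprod_split n psi (x : 'I_n -> C) (k : 'I_n) :
  pairprod psi x = (\prod_(j < n | j != k) (if (k < j)%N then psi (x k) (x j) else psi (x j) (x k))) *
    \prod_(i < n | i != k) \prod_(j < n | (i < j)%N && (j != k)) psi (x i) (x j).
Proof.
rewrite /pairprod (bigD1 k) //=.
have -> : \prod_(i < n | i != k) \prod_(j < n | (i < j)%N) psi (x i) (x j) =
   (\prod_(i < n | i != k) (if (i < k)%N then psi (x i) (x k) else 1)) *
   \prod_(i < n | i != k) \prod_(j < n | (i < j)%N && (j != k)) psi (x i) (x j).
  rewrite -big_split /=; apply: eq_bigr => i ik.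
  have [h|h] := boolP (i < k)%N; first by rewrite (bigD1 k).
  rewrite mul1r; apply: eq_bigl => j; case: (eqVneq j k) => [->|]; rewrite ?andbF ?andbT //.
  exact: negbTE.
rewrite mulrA; congr (_ * _).
rewrite big_mkcond [X in _ * X]big_mkcond [RHS]big_mkcond -big_split /=; apply: eq_bigr => j _.
have [->|jk] := eqVneq j k; first by rewrite ltnn mulr1.
case: ltngtP => h; rewrite ?mulr1 ?mul1r //.
by move: jk; rewrite -val_eqE /= h eqxx.
Qed.

(** Up to a sign depending on positions only, all factors containing the k-th
    variable can be written with that variable in first place. *)
Lemma pairprod_upd n psi (x : 'I_n -> C) (k : 'I_n) :
  (forall u v, u != 0 -> v != 0 -> psi v u = - psi u v) -> (forall j, x j != 0) ->
  exists K, forall z, z != 0 -> pairprod psi (upd x k z) = K * \prod_(j | j != k) psi z (x j).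
Proof.
move=> anti x0.
exists ((\prod_(j < n | j != k) (if (k < j)%N then 1 else -1)) *
   \prod_(i < n | i != k) \prod_(j < n | (i < j)%N && (j != k)) psi (x i) (x j)) => z z0.
rewrite (pairprod_split _ _ k) [RHS]mulrAC -[X in _ = X * _]big_split /=; congr (_ * _).
  apply: eq_bigr => j jk; rewrite updE updN //; case: ifP => _; first by rewrite mul1r.
  by rewrite anti // mulN1r.
by apply: eq_bigr => i ik; apply: eq_bigr => j /andP[_ jk]; rewrite !updN.
Qed.

Lemma pairprod_eq0 n psi (x : 'I_n -> C) i j : i != j ->
  psi (x i) (x j) = 0 -> psi (x j) (x i) = 0 -> pairprod psi x = 0.
Proof.
move=> ij h1 h2; rewrite (pairprod_split _ _ i) (bigD1 j) 1?eq_sym //=.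
by case: ifP => _; rewrite ?h1 ?h2 !mul0r.
Qed.

Lemma pairprod_recr n psi (x : 'I_n.+1 -> C) :
  pairprod psi x = pairprod psi (fun i => x (widen_ord (leqnSn n) i)) *
    \prod_(i < n) psi (x (widen_ord (leqnSn n) i)) (x ord_max).
Proof.
rewrite /pairprod big_ord_recr /= [X in _ * X]big1 ?mulr1; last first.
  by move=> j; rewrite ltnNge -ltnS ltn_ord.
rewrite -big_split /=; apply: eq_bigr => i _.
rewrite big_mkcond big_ord_recr /= ltn_ord; congr (_ * _).
by rewrite [RHS]big_mkcond.
Qed.

Lemma det_prop_rows n (A : 'M[C]_n) i j (mu : C) : i != j ->
  (forall l, A i l = mu * A j l) -> \det A = 0.
Proof.
move=> ij h; apply/eqP/det0P; exists (delta_mx 0 i - mu *: delta_mx 0 j).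
  apply/eqP => /rowP/(_ i); rewrite !mxE !eqxx (negbTE ij) mulr0 subr0 => /eqP.
  by rewrite oner_eq0.
rewrite mulmxBl -scalemxAl -!rowE; apply/rowP => l.
by rewrite !mxE h subrr.
Qed.

Lemma det_scale_rows n (r : 'I_n -> C) (B : 'I_n -> 'I_n -> C) :
  \det (\matrix_(i, j) (r i * B i j)) = (\prod_i r i) * \det (\matrix_(i, j) B i j).
Proof.
rewrite /determinant mulr_sumr; apply: eq_bigr => s _; rewrite mulrCA; congr (_ * _).
by rewrite -big_split /=; apply: eq_bigr => i _; rewrite !mxE.
Qed.

End Interpolation.

(** * Closure properties of theta functions *)

Section DeterminantA.
Variable R : realType.
Local Notation C := (Cplx R).
Variables (p : C) (hp : 0 < `|p| < 1).

(** Derivability at z depends only on the values near z. *)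
Lemma holo_ext0 (f g : C -> C) : (forall z, z != 0 -> f z = g z) -> holo f -> holo g.
Proof.
move=> fg hf z z0; have [d hd] := derivable_has (hf z z0).
apply: (@has_derivable _ _ _ d) => e /hd[r r0 hr].
exists (Num.min r (modulus z)); first by rewrite lt_min r0 modulus_gt0.
move=> h; rewrite lt_min => /andP[/hr h1 h2]; rewrite -!fg //.
apply/eqP => /eqP; rewrite addr_eq0 => /eqP e'.
by move: h2; rewrite e' modulusN ltxx.
Qed.

Lemma spaceA_ext m s f g : (forall z, z != 0 -> f z = g z) -> spaceA p m s f -> spaceA p m s g.
Proof.
move=> fg [hf qf]; split; first exact: holo_ext0 hf.
by move=> x x0; rewrite -!fg ?mulf_neq0 ?(p_neq0 hp) // qf.
Qed.

Lemma spaceA_scale m s (K : C) f : spaceA p m s f -> spaceA p m s (fun z => K * f z).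
Proof.
move=> [hf qf]; split; first by apply: holoM hf; apply: holo_cst.
by move=> x x0; rewrite qf // mulrCA.
Qed.

Lemma spaceA_sub m s f g : spaceA p m s f -> spaceA p m s g -> spaceA p m s (fun z => f z - g z).
Proof.
move=> [hf qf] [hg qg]; split; last by move=> x x0; rewrite qf // qg // mulrBr.
apply: (holo_ext (f := fun z => f z + (-1) * g z)); first by move=> z; rewrite mulN1r.
by apply: holoD hf _; apply: holoM hg; apply: holo_cst.
Qed.

Lemma spaceA_mul m s m' s' f g : s != 0 -> s' != 0 -> spaceA p m s f -> spaceA p m' s' g ->
  spaceA p (m + m') (s * s') (fun z => f z * g z).
Proof.
move=> s0 s0' [hf qf] [hg qg]; split; first exact: holoM.
by move=> x x0; rewrite qf // qg // !exprD; field; rewrite s0 s0' !expf_neq0.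
Qed.

Lemma spaceA_prodtheta n (Q : pred 'I_n) (a : 'I_n -> C) : (forall k, a k != 0) ->
  spaceA p #|Q| (\prod_(k | Q k) a k) (fun z => \prod_(k | Q k) theta p (a k * z)).
Proof.
move=> a0; split.
  apply: holo_prod => k _; apply: (holo_ext _ (holo_theta_lin hp (a0 k))) => z.
  by rewrite mulrC.
move=> x x0; rewrite (eq_bigr (fun k => - (a k * x)^-1 * theta p (a k * x))); last first.
  by move=> k _; rewrite mulrCA (theta_p hp) // mulf_neq0.
rewrite big_split /=; congr (_ * _).
rewrite -!prodr_const -big_split -prodfV -big_split /=.
by apply: eq_bigr => k _; field; rewrite x0 a0.
Qed.

(** The multiplier mu is the same for all f with the same factor h; this makes
    rows of a determinant proportional when two variables agree modulo powers of p. *)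
Lemma quasi_pk (h : C -> C) (x : C) (k : int) : (forall z, z != 0 -> h z != 0) -> x != 0 ->
  exists mu, forall f, (forall z, z != 0 -> f (p * z) = h z * f z) -> f (p ^ k * x) = mu * f x.
Proof.
move=> h0 x0; have p0 := p_neq0 hp.
have up n y : y != 0 -> exists2 mu, mu != 0 & forall f, (forall z, z != 0 -> f (p * z) = h z * f z) ->
    f (p ^+ n * y) = mu * f y.
  move=> y0; elim: n => [|n [mu mu0 IH]].
    by exists 1; rewrite ?oner_neq0 // => f _; rewrite !mul1r.
  exists (h (p ^+ n * y) * mu).
    by apply: mulf_neq0 => //; apply: h0; rewrite mulf_neq0 ?expf_neq0.
  move=> f hf; rewrite exprS -mulrA hf; last by apply: mulf_neq0 => //; apply: expf_neq0.
  by rewrite (IH f hf) mulrA.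
case: k => [n|n]; first by have [mu _ hmu] := up n x x0; exists mu.
have y0 : p ^ (Negz n) * x != 0 by rewrite mulf_neq0 // expfz_neq0.
have [mu mu0 hmu] := up n.+1 _ y0.
exists mu^-1 => f /hmu; rewrite mulrA /exprz mulfV ?expf_neq0 // mul1r => ->.
by rewrite mulKf.
Qed.

Lemma spaceA_pk m s x (k : int) : s != 0 -> x != 0 ->
  exists mu, forall f, spaceA p m s f -> f (p ^ k * x) = mu * f x.
Proof.
move=> s0 x0; have [|mu hmu] := @quasi_pk (fun z => (-1) ^+ m / (s * z ^+ m)) x k _ x0.
  by move=> z z0; rewrite mulf_neq0 ?signr_eq0 // invr_eq0 mulf_neq0 // expf_neq0.
by exists mu => f [_ /hmu].
Qed.

End DeterminantA.

(** * The determinant of type A *)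

Section DetA.
Variable R : realType.
Local Notation C := (Cplx R).
Variables (p : C) (hp : 0 < `|p| < 1).

Definition psiA (u v : C) := v * theta p (u / v).

Lemma psiA_anti u v : u != 0 -> v != 0 -> psiA v u = - psiA u v.
Proof.
move=> u0 v0; rewrite /psiA; have -> : v / u = (u / v)^-1 by rewrite invf_div.
by rewrite (thetaV hp) ?mulf_neq0 ?invr_eq0 //; field; rewrite u0 v0.
Qed.

Lemma thetaV_eq0 x : x != 0 -> (theta p x^-1 == 0) = (theta p x == 0).
Proof. by move=> x0; rewrite (thetaV hp) // mulf_eq0 oppr_eq0 invr_eq0 (negbTE x0). Qed.

Lemma theta_pk_eq0 (k : int) x : x != 0 -> theta p (p ^ k * x) = 0 <-> theta p x = 0.
Proof.
have qp z : z != 0 -> theta p (p * z) = - z^-1 * theta p z by exact: theta_p.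
have h0 (z : C) : z != 0 -> - z^-1 != 0 by move=> ?; rewrite oppr_eq0 invr_eq0.
have p0 := p_neq0 hp.
move=> x0; split=> h; last by have [mu ->] := quasi_pk hp k h0 x0; rewrite ?h ?mulr0.
have y0 : p ^ k * x != 0 by rewrite mulf_neq0 // expfz_neq0.
have [mu hmu] := quasi_pk hp (- k) h0 y0.
by have := hmu _ qp; rewrite h mulr0 mulrA -invr_expz mulVf ?expfz_neq0 // mul1r.
Qed.

(** Equality modulo multiplication by powers of p. *)
Definition eqvA (u v : C) := theta p (u / v) == 0.

Lemma eqvA_sym u v : u != 0 -> v != 0 -> eqvA u v = eqvA v u.
Proof.
move=> u0 v0; rewrite /eqvA -[RHS]thetaV_eq0 ?mulf_neq0 ?invr_eq0 //.
by rewrite invf_div.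
Qed.

Lemma eqvA_pk u v : u != 0 -> v != 0 -> eqvA u v -> exists k : int, u = p ^ k * v.
Proof.
move=> u0 v0 /eqP /(theta_eq0 hp)[|k hk]; first by rewrite mulf_neq0 ?invr_eq0.
by exists k; rewrite -hk divfK.
Qed.

Lemma eqvA_trans u v w : u != 0 -> v != 0 -> w != 0 -> eqvA u v -> eqvA v w -> eqvA u w.
Proof.
move=> u0 v0 w0 /(eqvA_pk u0 v0)[k ->] /eqP h; apply/eqP; rewrite -mulrA.
by apply/theta_pk_eq0; rewrite ?mulf_neq0 ?invr_eq0.
Qed.

Definition entryA n (a : 'I_n -> C) (P : 'I_n -> C -> C) (j : 'I_n) (z : C) :=
  P j z * \prod_(k < n | (j < k)%N) theta p (a k * z).

Lemma entryA_space n (c : C) (a : 'I_n -> C) (P : 'I_n -> C -> C) (j : 'I_n) :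
  c != 0 -> (forall k, a k != 0) ->
  spaceA p j.+1 (c * \prod_(k < n | (j < k)%N) a k)^-1 (P j) ->
  spaceA p n c^-1 (entryA a P j).
Proof.
move=> c0 a0 hP; have q0 : \prod_(k < n | (j < k)%N) a k != 0 by apply/prodf_neq0.
have := spaceA_mul _ q0 hP (spaceA_prodtheta hp (fun k : 'I_n => (j < k)%N) a0).
have -> : (c * \prod_(k < n | (j < k)%N) a k)^-1 * \prod_(k < n | (j < k)%N) a k = c^-1.
  by field; rewrite c0 q0.
have -> : (j.+1 + #|(fun k : 'I_n => (j < k)%N)|)%N = n.
  have -> : #|(fun k : 'I_n => (j < k)%N)| = (n - j.+1)%N.
    rewrite -sum1_card -(big_mkord (fun k : nat => (j < k)%N) (fun=> 1%N)).
    rewrite (@big_cat_nat _ _ _ j.+1) //=.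
    rewrite big_nat_cond big1 ?add0n; last by move=> i; lia.
    rewrite big_nat_cond (eq_bigl (fun i : nat => (j < i < n)%N && true)); last by move=> i; lia.
    by rewrite -big_nat_cond sum_nat_const_nat muln1.
  by rewrite subnKC.
by apply; rewrite invr_eq0 mulf_neq0.
Qed.

(** Induction on n by specializing x_n = 1 / a_n: then the last row has one nonzero
    entry, and the remaining minor is an instance of the same identity with n - 1
    variables and c replaced by c a_n, after extracting theta (a_n x_i)
    from its rows. *)
Theorem det_thetaA n (c : C) (x a : 'I_n -> C) (P : 'I_n -> C -> C) :
  c != 0 -> (forall k, a k != 0) -> (forall k, x k != 0) ->
  theta p (c * \prod_k a k)^-1 != 0 ->
  (forall j : 'I_n, spaceA p j.+1 (c * \prod_(k < n | (j < k)%N) a k)^-1 (P j)) ->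
  \det (\matrix_(i, j) entryA a P j (x i)) * theta p (c * \prod_k a k)^-1 =
  (\prod_i P i (a i)^-1) * theta p (c^-1 * \prod_k x k) *
    ((\prod_(i < n) \prod_(j < n | (i < j)%N) a j) * pairprod psiA x).
Proof.
elim: n c x a P => [|n IH] c x a P c0 a0 x0 th0 hP.
  rewrite det_mx00 /pairprod !big_ord0 !mulr1 !mul1r //.
set T := theta p (c * \prod_k a k)^-1 in th0 *.
pose D (x : 'I_n.+1 -> C) := \det (\matrix_(i, j) entryA a P j (x i)) * T -
  (\prod_i P i (a i)^-1) * theta p (c^-1 * \prod_k x k) *
    ((\prod_(i < n.+1) \prod_(j < n.+1 | (i < j)%N) a j) * pairprod psiA x).
suff H : D x = 0 by apply/eqP; rewrite -subr_eq0; apply/eqP.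
have ci0 : c^-1 != 0 by rewrite invr_eq0.
have hF j : spaceA p n.+1 c^-1 (entryA a P j) by apply: entryA_space.
have am0 : (a ord_max)^-1 != 0 by rewrite invr_eq0.
apply: (@vanish_by_interpolation R n (spaceA p n.+1 c^-1) eqvA
  (fun y => theta p (c^-1 * \prod_i y i) != 0) D (a ord_max)^-1) => //.
- exact: eqvA_sym.
- by move=> u u0; rewrite /eqvA divff // (theta1 hp).
- exact: eqvA_trans.
- move=> {x0 x} x i x0.
  have [K hK] := pairprod_upd i psiA_anti x0.
  pose M := \matrix_(i, j) entryA a P j (x i).
  apply: (@spaceA_ext _ _ hp _ _ (fun z => T * (\sum_j cofactor M i j * entryA a P j z) -
    ((\prod_i P i (a i)^-1) * (\prod_(i < n.+1) \prod_(j < n.+1 | (i < j)%N) a j) * K *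
      \prod_(k < n.+1 | k != i) x k) *
    (theta p (z * (c^-1 * \prod_(k < n.+1 | k != i) x k)) *
      \prod_(k < n.+1 | k != i) theta p (z / x k)))); last first.
    apply: spaceA_sub; apply: spaceA_scale; first exact: spaceA_lin.
    exact: spaceA_lagrange.
  move=> z z0; rewrite /D (expand_det_row _ i) hK // prod_upd.
  have -> : \prod_(k < n.+1 | k != i) psiA z (x k) =
     \prod_(k < n.+1 | k != i) x k * \prod_(k < n.+1 | k != i) theta p (z / x k).
    by rewrite -big_split.
  rewrite [z * (c^-1 * _)]mulrCA; congr (_ - _).
    rewrite [LHS]mulrC; congr (_ * _); apply: eq_bigr => j _.
    rewrite mxE updE; have -> : cofactor (\matrix_(k, l) entryA a P l (upd x i z k)) i j = cofactor M i j.
      rewrite /cofactor; congr (_ * \det _); apply/matrixP => k l.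
      by rewrite !mxE updN // eq_sym neq_lift.
    exact: mulrC.
  by ring.
- move=> {x0 x} x i j x0 ij eij.
  have [k hk] := eqvA_pk (x0 i) (x0 j) eij.
  have [mu hmu] := spaceA_pk hp n.+1 k ci0 (x0 j).
  rewrite /D (@det_prop_rows _ _ _ i j mu ij); last first.
    by move=> l; rewrite !mxE hk hmu.
  rewrite (@pairprod_eq0 _ _ psiA x i j ij) ?mul0r ?mulr0 ?subrr //.
    by rewrite /psiA (eqP eij) mulr0.
  by rewrite /psiA; move: eij; rewrite eqvA_sym // => /eqP ->; rewrite mulr0.
- move=> y f y0 yd yG hf fy.
  exact: (@spaceA_unisolvent _ p hp n.+1 c^-1 y f).
- move=> {x0 x} x x0 xm.
  pose w := widen_ord (leqnSn n); pose a' i := a (w i); pose x' i := x (w i).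
  pose P' i := P (w i).
  have cm0 : c * a ord_max != 0 by rewrite mulf_neq0.
  have cut (j : 'I_n) : \prod_(k < n.+1 | (w j < k)%N) a k =
      (\prod_(k < n | (j < k)%N) a' k) * a ord_max.
    by rewrite big_mkcond big_ord_recr /= ltn_ord [in RHS]big_mkcond.
  have call : c * \prod_k a k = c * a ord_max * \prod_k a' k.
    by rewrite big_ord_recr /= mulrAC -mulrA.
  have IH' : \det (\matrix_(i, j) entryA a' P' j (x' i)) * T =
    (\prod_i P' i (a' i)^-1) * theta p ((c * a ord_max)^-1 * \prod_k x' k) *
    ((\prod_(i < n) \prod_(j < n | (i < j)%N) a' j) * pairprod psiA x').
    rewrite /T call; apply: IH => //.
    - by move=> k; apply: a0.
    - by move=> k; apply: x0.
    - by rewrite -call.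
    - move=> j; have := hP (w j); rewrite cut.
      by rewrite [_ * a ord_max]mulrC mulrA.
  have lastrow j : j != ord_max -> entryA a P j (x ord_max) = 0.
    move=> jm; rewrite /entryA (bigD1 ord_max) /=; last first.
      by rewrite ltn_neqAle -ltnS ltn_ord andbT.
    by rewrite xm mulfV // (theta1 hp) mul0r mulr0.
  have Fw i j : entryA a P (w j) (x' i) = theta p (a ord_max * x' i) * entryA a' P' j (x' i).
    rewrite /entryA big_mkcond big_ord_recr /= ltn_ord [in RHS]big_mkcond /=.
    by rewrite [RHS]mulrC mulrA.
  have liftw i : lift ord_max i = w i by apply: val_inj; rewrite -[LHS]/(nat_of_ord (lift ord_max i)) lift_max.
  rewrite /D (expand_det_row _ ord_max) (bigD1 ord_max) //= big1 ?addr0; last first.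
    by move=> j jm; rewrite mxE lastrow ?mul0r.
  rewrite mxE /cofactor addnn -signr_odd odd_double expr0 mul1r.
  have -> : row' ord_max (col' ord_max (\matrix_(i, j) entryA a P j (x i))) =
      \matrix_(i, j) (theta p (a ord_max * x' i) * entryA a' P' j (x' i)).
    by apply/matrixP => i j; rewrite !mxE !liftw -Fw.
  rewrite det_scale_rows.
  have Fmm : entryA a P ord_max (x ord_max) = P ord_max (a ord_max)^-1.
    by rewrite /entryA xm big1 ?mulr1 // => k; rewrite ltnNge -ltnS ltn_ord.
  have regroup (u v d e : C) : u * (v * d) * e = u * v * (d * e) by ring.
  rewrite Fmm regroup IH' pairprod_recr.
  rewrite [\prod_i P i (a i)^-1]big_ord_recr [\prod_k x k]big_ord_recr /= xm.
  have -> : \prod_(i < n.+1) \prod_(j < n.+1 | (i < j)%N) a j =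
      (\prod_(i < n) \prod_(j < n | (i < j)%N) a' j) * \prod_(i < n) a ord_max.
    rewrite big_ord_recr /= [X in _ * X]big1 ?mulr1; last first.
      by move=> j; rewrite ltnNge -ltnS ltn_ord.
    by rewrite -big_split /=; apply: eq_bigr => i _; rewrite cut.
  have -> : \prod_(i < n) psiA (x (widen_ord (leqnSn n) i)) (a ord_max)^-1 =
     (\prod_(i < n) a ord_max)^-1 * \prod_(i < n) theta p (a ord_max * x' i).
    rewrite -prodfV -big_split /=; apply: eq_bigr => i _.
    by rewrite /psiA invrK [_ * a ord_max]mulrC.
  have -> : c^-1 * (\prod_(i < n) x (widen_ord (leqnSn n) i) / a ord_max) =
     (c * a ord_max)^-1 * \prod_k x' k.
    by rewrite invfM; ring.
  have pa0 : \prod_(i < n) a ord_max != 0 by apply/prodf_neq0.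
  apply/eqP; rewrite subr_eq0; apply/eqP.
  rewrite -[\prod_(i < n) P (widen_ord (leqnSn n) i) _]/(\prod_(i < n) P' i (a' i)^-1).
  rewrite -[pairprod psiA (fun i => x _)]/(pairprod psiA x').
  by field.
- move=> {x0 x} x i x0 im.
  pose q1 := c^-1 * \prod_(k < n.+1 | k != i) x k.
  pose q2 := c^-1 * ((a ord_max)^-1 * \prod_(k < n.+1 | (k != ord_max) && (k != i)) x k).
  have q10 : q1 != 0 by rewrite mulf_neq0 //; apply/prodf_neq0.
  have q20 : q2 != 0 by rewrite !mulf_neq0 //; apply/prodf_neq0.
  have [t t0 ht] := generic_point hp ([:: q1; q2; a ord_max] ++ [seq (x k)^-1 | k <- enum 'I_n.+1]).
  exists t; split => //.
  + move=> k; apply: ht; rewrite ?invr_eq0 //.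
    have mk : (x k)^-1 \in [seq (x l)^-1 | l <- enum 'I_n.+1] by apply/mapP; exists k; rewrite ?mem_enum.
    by rewrite !inE mk !orbT.
  + by rewrite /eqvA invrK; apply: ht; rewrite // !inE eqxx !orbT.
  + by rewrite prod_upd mulrCA; apply: ht => //; rewrite !inE eqxx.
  + rewrite prod_upd (bigD1 i) //= updE.
    rewrite (eq_bigr x); last by move=> k /andP[_ ki]; rewrite updN.
    have -> : c^-1 * ((a ord_max)^-1 * (t * \prod_(k < n.+1 | (k != ord_max) && (k != i)) x k)) = t * q2.
      by rewrite /q2; ring.
    by apply: ht => //; rewrite !inE eqxx orbT.
- move=> n0 y y0; rewrite prod_upd.
  have E (z : 'I_n.+1 -> C) : \prod_(k < n.+1 | k != ord_max) z k = 1.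
    rewrite big_pred0 // => k; apply/negbTE; rewrite negbK -val_eqE /=.
    by have := ltn_ord k; rewrite ltnS {2}n0 leqn0 => /eqP ->; rewrite n0.
  by move: th0; rewrite /T (bigD1 ord_max) //= !E !mulr1 invfM.
Qed.

End DetA.

(** * Permuting the variables of a product over pairs *)

Section PairprodPerm.
Variable R : realType.
Local Notation C := (Cplx R).

(** The sign of s as a product over inversions. *)
Definition inv_sign n (s : 'S_n) : C :=
  \prod_(i < n) \prod_(j < n | (i < j)%N) (if ((s^-1)%g i < (s^-1)%g j)%N then 1 else -1).

(** Reindexing by the inverse of s turns the pairs i < j into the pairs with
    s^-1 i < s^-1 j; each inverted pair contributes a sign. *)
Lemma pairprod_inv n psi (x : 'I_n -> C) (s : 'S_n) :
  (forall u v, u != 0 -> v != 0 -> psi v u = - psi u v) -> (forall i, x i != 0) ->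
  pairprod psi (fun i => x (s i)) = inv_sign s * pairprod psi x.
Proof.
move=> anti x0; rewrite /pairprod /inv_sign.
rewrite !pair_big_dep /= -big_split /=.
pose h (q : 'I_n * 'I_n) := ((s^-1)%g q.1, (s^-1)%g q.2).
have hi : injective h by move=> [a b] [c d] [/perm_inj -> /perm_inj ->].
rewrite (reindex_inj hi) /= /h.
under eq_bigr do rewrite !permKV.
rewrite (bigID (fun q : 'I_n * 'I_n => (q.1 < q.2)%N)) [RHS](bigID (fun q : 'I_n * 'I_n => ((s^-1)%g q.1 < (s^-1)%g q.2)%N)) /=.
congr (_ * _).
  apply: eq_big => [q|q /andP[-> _]]; first exact: andbC.
  by rewrite mul1r.
pose sw (q : 'I_n * 'I_n) := (q.2, q.1).
have swi : injective sw by move=> [a b] [c d] [-> ->].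
rewrite (reindex_inj swi) /=; apply: eq_big => [[i j]|[i j]] /=.
  have [->|ij] := eqVneq i j; first by rewrite !ltnn.
  have ij' : (i : nat) != j by rewrite val_eqE.
  have sij : nat_of_ord ((s^-1)%g i) != (s^-1)%g j by rewrite val_eqE (inj_eq perm_inj).
  by lia.
move=> /andP[h1 _]; rewrite ltnNge ltnW //= mulN1r.
by rewrite -anti.
Qed.

(** The sign in [pairprod_inv] does not depend on psi, so it can be read off from a
    nonzero Vandermonde determinant. *)
Lemma inv_signE n (s : 'S_n) : inv_sign s = (-1) ^+ s.
Proof.
pose v (i : 'I_n) : C := i.+1%:R.
have v0 i : v i != 0 by rewrite pnatr_eq0.
pose psi (a b : C) := b - a.
have anti a b : a != 0 -> b != 0 -> psi b a = - psi a b by rewrite /psi opprB.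
have detv (w : 'I_n -> C) : pairprod psi w = \det (Vandermonde n (\row_i w i)).
  by rewrite det_Vandermonde; apply: eq_bigr => i _; apply: eq_bigr => j _; rewrite !mxE.
have nz : pairprod psi v != 0.
  apply/prodf_neq0 => i _; apply/prodf_neq0 => j ij.
  by rewrite /psi /v subr_eq0 eqr_nat eqSS gtn_eqF.
apply: (mulIf nz); rewrite -pairprod_inv // !detv.
have -> : Vandermonde n (\row_i v (s i)) = col_perm s (Vandermonde n (\row_i v i)).
  by apply/matrixP => i j; rewrite !mxE.
by rewrite col_permE det_mulmx det_perm mulrC odd_permV.
Qed.

Lemma pairprod_tperm n psi (x : 'I_n -> C) i j : i != j ->
  (forall u v, u != 0 -> v != 0 -> psi v u = - psi u v) -> (forall i, x i != 0) ->
  pairprod psi (fun k => x (tperm i j k)) = - pairprod psi x.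
Proof. by move=> ij anti x0; rewrite pairprod_inv // inv_signE odd_tperm ij mulN1r. Qed.

End PairprodPerm.

(** * The sum over sign changes *)

Section SignSum.
Variable R : realType.
Local Notation C := (Cplx R).
Variables (p : C) (hp : 0 < `|p| < 1).

Definition flip n (x : 'I_n -> C) (e : {ffun 'I_n -> bool}) : 'I_n -> C :=
  fun i => if e i then (x i)^-1 else x i.

Lemma flip_neq0 n (x : 'I_n -> C) e : (forall i, x i != 0) -> forall i, flip x e i != 0.
Proof. by move=> x0 i; rewrite /flip; case: ifP => _; rewrite ?invr_eq0. Qed.

Definition phi m (c : 'I_m -> C) (z : C) : C := z ^- m.+1 * \prod_(k < m) theta p (c k * z).

(** The product of the row factors phi (y_i) and of the evaluated determinant of
    type A, up to factors independent of y. *)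
Definition signed_term m (c : 'I_m -> C) (y : 'I_m.+2 -> C) : C :=
  (\prod_i phi c (y i)) * (theta p ((\prod_k c k)^-1 * \prod_i y i) * pairprod (psiA p) y).

Definition signsum m (c : 'I_m -> C) (x : 'I_m.+2 -> C) : C :=
  \sum_(e : {ffun 'I_m.+2 -> bool}) signed_term c (flip x e).

Lemma psiD_anti u v : u != 0 -> v != 0 -> psiD p v u = - psiD p u v.
Proof.
move=> u0 v0; rewrite /psiD /theta_pm; have -> : v / u = (u / v)^-1 by rewrite invf_div.
by rewrite (thetaV hp) ?mulf_neq0 ?invr_eq0 // (mulrC v u); field; rewrite u0 v0.
Qed.

Lemma psiD_Vr u v : u != 0 -> v != 0 -> psiD p u v^-1 = psiD p u v.
Proof. by move=> u0 v0; rewrite /psiD /theta_pm invrK [theta p _ * _]mulrC. Qed.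

Lemma signed_term_tperm m (c : 'I_m -> C) (y : 'I_m.+2 -> C) i j : i != j -> (forall k, y k != 0) ->
  signed_term c (fun k => y (tperm i j k)) = - signed_term c y.
Proof.
move=> ij y0; rewrite /signed_term pairprod_tperm //; last exact: psiA_anti.
rewrite [in RHS](reindex_inj (@perm_inj _ (tperm i j))) /=.
by rewrite [\prod_k y k](reindex_inj (@perm_inj _ (tperm i j))) /= !mulrN.
Qed.

(** Exchanging the signs of the two equal variables changes the sign of every term. *)
Lemma signsum_eq0 m (c : 'I_m -> C) (x : 'I_m.+2 -> C) i j : i != j -> (forall k, x k != 0) ->
  x i = x j -> signsum c x = 0.
Proof.
move=> ij x0 xij.
pose h (e : {ffun 'I_m.+2 -> bool}) := [ffun k => e (tperm i j k)].
have hK : involutive h by move=> e; apply/ffunP => k; rewrite !ffunE tpermK.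
have H : signsum c x = - signsum c x.
  rewrite {1}/signsum (reindex_inj (inv_inj hK)) /= -sumrN; apply: eq_bigr => e _.
  rewrite -(signed_term_tperm c ij (flip_neq0 _ x0)); congr signed_term; apply/funext => k.
  rewrite /flip ffunE; case: tpermP => [->|->|//]; by rewrite ?xij -?xij.
have : signsum c x *+ 2 = 0 by rewrite mulr2n {2}H subrr.
by move/eqP; rewrite mulrn_eq0 /= => /eqP.
Qed.

Lemma flip_inv n (x : 'I_n -> C) i z e :
  flip (upd x i z^-1) e = flip (upd x i z) [ffun k => (k == i) (+) e k].
Proof.
apply/funext => k; rewrite /flip /upd ffunE; case: (k == i) => //=.
by case: (e k); rewrite ?invrK.
Qed.

(** Inverting a variable permutes the sign changes. *)
Lemma signsum_inv m (c : 'I_m -> C) (x : 'I_m.+2 -> C) i z :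
  signsum c (upd x i z^-1) = signsum c (upd x i z).
Proof.
pose h (e : {ffun 'I_m.+2 -> bool}) := [ffun k => (k == i) (+) e k].
have hK : involutive h by move=> e; apply/ffunP => k; rewrite !ffunE addKb.
rewrite [RHS]/signsum (reindex_inj (inv_inj hK)) /=.
by apply: eq_bigr => e _; rewrite flip_inv.
Qed.

Definition quasiD M (f : C -> C) := holo f /\
  forall x, x != 0 -> f (p * x) = (p * x ^+ 2) ^- M * f x.

Lemma quasiD_inv M f : quasiD M f -> quasiD M (fun z => f z^-1).
Proof.
move=> [hf qf]; have p0 := p_neq0 hp; split.
  by apply: (holo_comp hf (holoV (@holo_id R) _)) => // z; rewrite invr_eq0.
move=> x x0; have w0 : (p * x)^-1 != 0 by rewrite invr_eq0 mulf_neq0.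
have := qf _ w0; rewrite -[p * (p * x)^-1]/(p / (p * x)).
have -> : p / (p * x) = x^-1 by field; rewrite x0 p0.
have -> : p * (p * x)^-1 ^+ 2 = (p * x ^+ 2)^-1 by field; rewrite p0 x0.
by rewrite exprVn invrK => ->; rewrite mulKf // expf_neq0 // mulf_neq0 // expf_neq0.
Qed.

Lemma quasiD_ext M f g : (forall z, z != 0 -> f z = g z) -> quasiD M f -> quasiD M g.
Proof.
move=> fg [hf qf]; split; first exact: holo_ext0 hf.
by move=> x x0; rewrite -!fg ?mulf_neq0 ?(p_neq0 hp) // qf.
Qed.

Lemma quasiD_scale M (K : C) f : quasiD M f -> quasiD M (fun z => K * f z).
Proof.
move=> [hf qf]; split; first by apply: holoM hf; apply: holo_cst.
by move=> x x0; rewrite qf // mulrCA.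
Qed.

(** The norms of the theta factors multiply to 1, because the norm of the type A
    determinant is the inverse of the product of the c_k. *)
Lemma signed_term_quasi m (c : 'I_m -> C) (y : 'I_m.+2 -> C) i : (forall k, c k != 0) -> (forall k, y k != 0) ->
  quasiD m.+1 (fun z => signed_term c (upd y i z)).
Proof.
move=> c0 y0; have [K hK] := pairprod_upd i (psiA_anti hp) y0.
have q0 : \prod_k c k != 0 by apply/prodf_neq0.
have s0 : (\prod_k c k)^-1 != 0 by rewrite invr_eq0.
pose E z := \prod_(k | predT k) theta p (c k * z) *
   (theta p (z * ((\prod_k c k)^-1 * \prod_(k < m.+2 | k != i) y k)) *
      \prod_(k < m.+2 | k != i) theta p (z / y k)).
have [hE qE] := spaceA_mul q0 s0 (spaceA_prodtheta hp predT c0) (spaceA_lagrange hp i s0 y0).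
have p0 := p_neq0 hp.
have {}qE z : z != 0 -> E (p * z) = z ^- (m.+1 + m.+1) * E z.
  move=> z0; rewrite {1}/E qE // cardE size_enum_ord mulfV // mul1r addnS -addSn -/(E z).
  by rewrite exprD -exprMn mulrNN mulr1 expr1n mul1r.
have : quasiD m.+1 (fun z => z ^- m.+1 * E z).
  split.
    by apply: holoM hE; apply: holoV => [|z z0]; [apply: holoX; apply: holo_id | rewrite expf_neq0].
  move=> x x0; rewrite qE // !exprMn exprD; field.
  by rewrite ?expf_neq0 ?p0 ?x0.
move=> /(quasiD_scale ((\prod_(k < m.+2 | k != i) phi c (y k)) * K * \prod_(k < m.+2 | k != i) y k)).
apply: quasiD_ext => z z0; rewrite /signed_term hK // prod_upd [in RHS](bigD1 i) //= updE.
have -> : \prod_(k < m.+2 | k != i) phi c (upd y i z k) = \prod_(k < m.+2 | k != i) phi c (y k).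
  by apply: eq_bigr => k ki; rewrite updN.
have -> : \prod_(k < m.+2 | k != i) psiA p z (y k) =
     \prod_(k < m.+2 | k != i) y k * \prod_(k < m.+2 | k != i) theta p (z / y k).
  by rewrite -big_split.
rewrite [(\prod_k c k)^-1 * (z * _)]mulrCA /E [phi c z]/phi /=.
by ring.
Qed.

End SignSum.

(** * Evaluation of the sum over sign changes *)

Section SignSumEval.
Variable R : realType.
Local Notation C := (Cplx R).
Variables (p : C) (hp : 0 < `|p| < 1).

Lemma quasiD_sum M (I : finType) (F : I -> C -> C) :
  (forall i, quasiD p M (F i)) -> quasiD p M (fun z => \sum_i F i z).
Proof.
move=> h; split; first by apply: holo_sum => i _; apply: (h i).1.
by move=> x x0; rewrite mulr_sumr; apply: eq_bigr => i _; rewrite (h i).2.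
Qed.

Lemma flip_upd n (x : 'I_n -> C) i z e : flip (upd x i z) e = upd (flip x e) i (if e i then z^-1 else z).
Proof. by apply/funext => k; rewrite /flip /upd; case: eqP => [->|]. Qed.

Lemma signsum_spaceD m (c : 'I_m -> C) (x : 'I_m.+2 -> C) i : (forall k, c k != 0) -> (forall k, x k != 0) ->
  spaceD p m.+1 (fun z => signsum p c (upd x i z)).
Proof.
move=> c0 x0.
have [hf qf] : quasiD p m.+1 (fun z => signsum p c (upd x i z)).
  apply: quasiD_sum => e.
  have q := signed_term_quasi hp i c0 (flip_neq0 e x0).
  case he : (e i).
    apply: (quasiD_ext hp _ (quasiD_inv hp q)) => z _.
    by rewrite flip_upd he.
  by apply: (quasiD_ext hp _ q) => z _; rewrite flip_upd he.
by split=> // z _; rewrite signsum_inv.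
Qed.

(** Equality up to inversion and multiplication by powers of p. *)
Definition eqvD (u v : C) := theta_pm p u v == 0.

Lemma eqvDE u v : eqvD u v = eqvA p u v^-1 || eqvA p u v.
Proof. by rewrite /eqvD /eqvA invrK mulf_eq0. Qed.

Lemma eqvA_VV u v : u != 0 -> v != 0 -> eqvA p u^-1 v^-1 = eqvA p u v.
Proof.
move=> u0 v0; rewrite [RHS]eqvA_sym // /eqvA invrK.
by rewrite mulrC.
Qed.

Lemma eqvD_sym u v : u != 0 -> v != 0 -> eqvD u v = eqvD v u.
Proof.
move=> u0 v0; have ui0 : u^-1 != 0 by rewrite invr_eq0.
have vi0 : v^-1 != 0 by rewrite invr_eq0.
by rewrite !eqvDE -(eqvA_VV u0 vi0) invrK eqvA_sym // (eqvA_sym hp u0 v0).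
Qed.

Lemma eqvD_trans u v w : u != 0 -> v != 0 -> w != 0 -> eqvD u v -> eqvD v w -> eqvD u w.
Proof.
move=> u0 v0 w0; have vi0 : v^-1 != 0 by rewrite invr_eq0.
have wi0 : w^-1 != 0 by rewrite invr_eq0.
rewrite !eqvDE => /orP[] uv /orP[] vw; apply/orP.
- right; apply: eqvA_trans uv _ => //; by rewrite -eqvA_VV // invrK.
- left; apply: eqvA_trans uv _ => //; by rewrite eqvA_VV.
- by left; apply: eqvA_trans uv _.
- by right; apply: eqvA_trans uv _.
Qed.

Lemma spaceD_eqvD0 m f u v : u != 0 -> v != 0 -> eqvD u v -> spaceD p m f -> f v = 0 -> f u = 0.
Proof.
move=> u0 v0; have vi0 : v^-1 != 0 by rewrite invr_eq0.
have h0 (z : C) : z != 0 -> (p * z ^+ 2) ^- m != 0.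
  by move=> z0; rewrite invr_eq0 !expf_neq0 // mulf_neq0 ?(p_neq0 hp) // expf_neq0.
rewrite eqvDE => /orP[] /(eqvA_pk hp u0)[]// k -> [_ qf sf] fv.
  by have [mu hmu] := quasi_pk hp k h0 vi0; rewrite (hmu f qf) sf // fv mulr0.
by have [mu hmu] := quasi_pk hp k h0 v0; rewrite (hmu f qf) fv mulr0.
Qed.

Lemma sum_ffun_recr n (F : {ffun 'I_n.+1 -> bool} -> C) :
  (forall e : {ffun 'I_n.+1 -> bool}, e ord_max -> F e = 0) ->
  \sum_e F e = \sum_(e : {ffun 'I_n -> bool}) F [ffun i => oapp e false (unlift ord_max i)].
Proof.
move=> F0; rewrite (bigID (fun e : {ffun 'I_n.+1 -> bool} => e ord_max)) /= big1 ?add0r //.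
pose ext (e : {ffun 'I_n -> bool}) : {ffun 'I_n.+1 -> bool} := [ffun i => oapp e false (unlift ord_max i)].
pose res (e : {ffun 'I_n.+1 -> bool}) : {ffun 'I_n -> bool} := [ffun i => e (lift ord_max i)].
rewrite (reindex_onto ext res) /=.
  apply: eq_bigl => e; rewrite ffunE unlift_none /=; apply/eqP/ffunP => i.
  by rewrite !ffunE liftK.
move=> e /negbTE he; apply/ffunP => i; rewrite ffunE.
by case: unliftP => [j ->|->] /=; rewrite ?ffunE // he.
Qed.

Lemma pairprod2 psi (y : 'I_2 -> C) : pairprod psi y = psi (y ord0) (y ord_max).
Proof.
rewrite !pairprod_recr {1}/pairprod !big_ord0 !mul1r big_ord1.
by congr (psi (y _) _); apply: val_inj.
Qed.

(** Induction on m by specializing the last variable to b = c_m, the last parameter.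
    Since phi (1/b) = 0, only sign changes that fix the last variable
    survive; the factors of a term that contain b combine, for each other variable
    u, into b times [psiD u b], which is invariant under u -> 1/u and therefore
    comes out of the sum.  For two variables all four terms are equal. *)
Theorem signsum_eval m (c : 'I_m -> C) (x : 'I_m.+2 -> C) : (forall k, c k != 0) -> (forall k, x k != 0) ->
  signsum p c x = 4 * (\prod_(i < m) \prod_(j < m | (i <= j)%N) theta p (c i * c j)) * pairprod (psiD p) x.
Proof.
elim: m c x => [|m IH] c x c0 x0.
  rewrite /signsum.
  (* with two variables and no parameters, a signed term is psiD, which is invariant under inversions *)
  have E (y : 'I_2 -> C) : (forall k, y k != 0) -> signed_term p c y = psiD p (y ord0) (y ord_max).
    move=> y0; rewrite /signed_term /phi pairprod2.
    have two (f : 'I_2 -> C) : \prod_i f i = f ord0 * f ord_max.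
      by rewrite big_ord_recr big_ord1 /=; congr (f _ * f _); apply: val_inj.
    rewrite !two !big_ord0 !mulr1 invr1 mul1r /psiA /psiD /theta_pm !expr1.
    by field; rewrite !y0.
  rewrite (eq_bigr (fun=> psiD p (x ord0) (x ord_max))); last first.
    move=> e _; rewrite E; last exact: flip_neq0.
    by rewrite /flip; case: (e _); case: (e _); rewrite ?(psiD_V hp) ?psiD_Vr ?invr_eq0.
  rewrite sumr_const card_ffun card_bool card_ord big_ord0 mulr1 mulr_natl.
  by rewrite pairprod2.
pose D (x : 'I_m.+3 -> C) := signsum p c x -
  4 * (\prod_(i < m.+1) \prod_(j < m.+1 | (i <= j)%N) theta p (c i * c j)) * pairprod (psiD p) x.
suff H : D x = 0 by apply/eqP; rewrite -subr_eq0; apply/eqP.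
apply: (@vanish_by_interpolation R m.+2 (spaceD p m.+2) eqvD (fun=> true) D (c ord_max)) => //.
- exact: eqvD_sym.
- by move=> u u0; rewrite eqvDE /eqvA divff // (theta1 hp) eqxx orbT.
- exact: eqvD_trans.
- move=> {x0 x} x i x0; have [K hK] := pairprod_upd i (psiD_anti hp) x0.
  have [h1 q1 s1] := signsum_spaceD i c0 x0.
  have := spaceD_prod hp [pred k | k != i] x0; rewrite cardC1 card_ord => -[h2 q2 s2].
  set K' := 4 * (\prod_(i < m.+1) \prod_(j < m.+1 | (i <= j)%N) theta p (c i * c j)).
  split=> [|z z0|z z0].
  + apply: (holo_ext0 (f := fun z => signsum p c (upd x i z) + (- (K' * K)) * \prod_(k < m.+3 | k != i) psiD p z (x k))).
      by move=> z z0; rewrite /D hK // -/K' mulNr mulrA.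
    by apply: holoD h1 _; apply: holoM h2; apply: holo_cst.
  + by rewrite /D !hK ?mulf_neq0 ?(p_neq0 hp) // q1 // q2 // mulrBr [K * _]mulrCA [_ * (_ * (K * _))]mulrCA.
  + by rewrite /D !hK ?invr_eq0 // s1 // s2.
- move=> {x0 x} x i j x0 ij eij; rewrite /D (@pairprod_eq0 _ _ (psiD p) x i j ij).
  + rewrite mulr0 subr0 -(upd_id x i).
    apply: (spaceD_eqvD0 (x0 i) (x0 j) eij (signsum_spaceD i c0 x0)).
    apply: (signsum_eq0 hp _ ij); first exact: upd_neq0.
    by rewrite updE updN // eq_sym.
  + by rewrite /psiD (eqP eij) mulr0.
  + by rewrite psiD_anti // /psiD (eqP eij) mulr0 oppr0.
- move=> y f y0 yd _; exact: (spaceD_unisolvent hp).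
- move=> {x0 x} x x0 xm.
  pose w := widen_ord (leqnSn m.+2); pose x' i := x (w i).
  pose c' i := c (widen_ord (leqnSn m) i); pose b := c ord_max.
  have b0 : b != 0 by apply: c0.
  have x0' i : x' i != 0 by apply: x0.
  have c0' i : c' i != 0 by apply: c0.
  have cut : \prod_k c k = (\prod_k c' k) * b by rewrite big_ord_recr.
  have phiS z : z != 0 -> phi p c z = z^-1 * theta p (z * b) * phi p c' z.
    move=> z0; rewrite /phi big_ord_recr /= -/b -/(c' _) [b * z]mulrC exprS; field.
    by rewrite z0 expf_neq0.
  have phi0 : phi p c b^-1 = 0.
    by rewrite /phi big_ord_recr /= -/b mulfV // (theta1 hp) !mulr0.
  rewrite /D /signsum sum_ffun_recr; last first.
    move=> e he; rewrite /signed_term (bigD1 ord_max) //= {1}/flip he xm phi0 !mul0r //.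
  have ext (e : {ffun 'I_m.+2 -> bool}) :
      signed_term p c (flip x [ffun i => oapp e false (unlift ord_max i)]) =
      (phi p c b * \prod_(i < m.+2) (b * psiD p (x' i) b)) * signed_term p c' (flip x' e).
    set y := flip x _.
    have ym : y ord_max = b by rewrite /y /flip ffunE unlift_none /= xm.
    have liftw i : lift ord_max i = w i by apply: val_inj; rewrite -[LHS]/(nat_of_ord (lift ord_max i)) lift_max.
    have yw i : y (w i) = flip x' e i by rewrite /y /flip ffunE -liftw liftK /= liftw.
    set y' := flip x' e in yw *.
    have y0' i : y' i != 0 by apply: flip_neq0.
    rewrite /signed_term pairprod_recr big_ord_recr [\prod_i y i]big_ord_recr /= ym.
    rewrite (eq_bigr (fun i => phi p c (y' i))); last by move=> i _; rewrite -yw.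
    rewrite [\prod_(i < m.+2) y _](eq_bigr y'); last by move=> i _; rewrite -yw.
    rewrite (_ : (fun i => y _) = y'); last by apply/funext => i; rewrite -yw.
    rewrite [\prod_(i < m.+2) psiA p _ _](eq_bigr (fun i => psiA p (y' i) b)); last by move=> i _; rewrite -yw.
    rewrite cut; have -> : (\prod_k c' k * b)^-1 * (\prod_i y' i * b) = (\prod_k c' k)^-1 * \prod_i y' i.
      have Q0 : \prod_k c' k != 0 by apply/prodf_neq0.
      by field; rewrite b0 Q0.
    have -> : \prod_(i < m.+2) phi p c (y' i) * phi p c b = phi p c b *
        ((\prod_(i < m.+2) ((y' i)^-1 * theta p (y' i * b))) * \prod_(i < m.+2) phi p c' (y' i)).
      by rewrite mulrC -big_split /=; congr (_ * _); apply: eq_bigr => i _; rewrite phiS.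
    have -> : \prod_(i < m.+2) (b * psiD p (x' i) b) =
       (\prod_(i < m.+2) ((y' i)^-1 * theta p (y' i * b))) * \prod_(i < m.+2) psiA p (y' i) b.
      rewrite -big_split /=; apply: eq_bigr => i _.
      have -> : psiD p (x' i) b = psiD p (y' i) b.
        by rewrite /y' /flip; case: (e i) => //; rewrite (psiD_V hp).
      by rewrite /psiD /theta_pm /psiA; ring.
    by ring.
  rewrite (eq_bigr _ (fun e _ => ext e)) -mulr_sumr -/(signsum p c' x') IH // [pairprod _ x]pairprod_recr xm -/b.
  rewrite big_split /= prodr_const card_ord.
  have -> : \prod_(i < m.+1) \prod_(j < m.+1 | (i <= j)%N) theta p (c i * c j) =
     (\prod_(i < m) \prod_(j < m | (i <= j)%N) theta p (c' i * c' j)) * \prod_(k < m.+1) theta p (c k * b).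
    rewrite big_ord_recr [\prod_(k < m.+1) theta p (c k * b)]big_ord_recr /= mulrA; congr (_ * _).
      rewrite -big_split /=; apply: eq_bigr => i _.
      by rewrite big_mkcond big_ord_recr /= ltnW ?ltn_ord // [in RHS]big_mkcond.
    rewrite big_mkcond big_ord_recr /= leqnn big1 ?mul1r // => i _.
    by rewrite leqNgt ltn_ord.
  rewrite -[pairprod _ (fun i => x _)]/(pairprod (psiD p) x').
  rewrite -[\prod_(i < m.+2) psiD p (x _) b]/(\prod_(i < m.+2) psiD p (x' i) b).
  by rewrite /phi; field; rewrite expf_neq0.
- move=> {x0 x} x i x0 im.
  have [t t0 ht] := generic_point hp ([:: c ord_max; (c ord_max)^-1] ++ [seq x k | k <- enum 'I_m.+3]
     ++ [seq (x k)^-1 | k <- enum 'I_m.+3]).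
  exists t; split=> // [k|].
    rewrite /eqvD /theta_pm mulf_neq0 ?ht ?invr_eq0 //.
      by rewrite !mem_cat map_f ?orbT // mem_enum.
    have mk : (x k)^-1 \in [seq (x l)^-1 | l <- enum 'I_m.+3] by apply/mapP; exists k; rewrite ?mem_enum.
    by rewrite !mem_cat mk !orbT.
  by rewrite /eqvD /theta_pm mulf_neq0 ?ht ?invr_eq0 // !inE eqxx ?orbT.
Qed.

End SignSumEval.

(** * The determinant of type D *)

Section Final.
Variable R : realType.
Local Notation C := (Cplx R).

Lemma det_sum_rows n (g : 'I_n -> bool -> 'I_n -> C) :
  \det (\matrix_(i, j) \sum_b g i b j) =
  \sum_(e : {ffun 'I_n -> bool}) \det (\matrix_(i, j) g i (e i) j).
Proof.
rewrite /determinant exchange_big; apply: eq_bigr => s _ /=; rewrite -mulr_sumr; congr (_ * _).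
transitivity (\prod_i \sum_b g i b (s i)); first by apply: eq_bigr => i _; rewrite mxE.
by rewrite bigA_distr_bigA /=; apply: eq_bigr => e _; apply: eq_bigr => i _; rewrite mxE.
Qed.

(** Expanding each row as a sum over the two signs writes the determinant as a sum of
    type A determinants, all with the same constant, times row factors. *)
Theorem det_thetaD (p : C) (hp : 0 < `|p| < 1) m (x a : 'I_m.+2 -> C) (c : 'I_m -> C)
  (P : 'I_m.+2 -> C -> C) :
  (forall i, x i != 0) -> (forall i, a i != 0) -> (forall k, c k != 0) ->
  theta p ((\prod_k c k) * \prod_k a k) != 0 ->
  (forall j : 'I_m.+2, spaceA p j.+1 ((\prod_k c k) * \prod_(k < m.+2 | (j < k)%N) a k)^-1 (P j)) ->
  \det (\matrix_(i, j) (phi p c (x i) * entryA p a P j (x i) +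
                        phi p c (x i)^-1 * entryA p a P j (x i)^-1)) =
  - (4 * (\prod_k a k) * (\prod_k c k) / theta p ((\prod_k c k) * \prod_k a k))
  * (\prod_i P i (a i)^-1)
  * (\prod_(i < m) \prod_(j < m | (i <= j)%N) theta p (c i * c j))
  * ((\prod_(i < m.+2) \prod_(j < m.+2 | (i < j)%N) a j) * pairprod (psiD p) x).
Proof.
move=> x0 a0 c0 hden hP.
have C0 : \prod_k c k != 0 by apply/prodf_neq0.
have A0 : \prod_k a k != 0 by apply/prodf_neq0.
set CA := _ * \prod_k a k in hden *; have CA0 : CA != 0 by rewrite mulf_neq0.
have T0 : theta p CA^-1 != 0 by rewrite (thetaV hp) // mulf_neq0 // oppr_eq0 invr_eq0.
pose g i b j := phi p c (if b then (x i)^-1 else x i) * entryA p a P j (if b then (x i)^-1 else x i).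
have -> : \matrix_(i, j) (phi p c (x i) * entryA p a P j (x i) +
     phi p c (x i)^-1 * entryA p a P j (x i)^-1) = \matrix_(i, j) \sum_b g i b j.
  by apply/matrixP => i j; rewrite !mxE big_bool /= addrC.
rewrite det_sum_rows; apply: (mulIf T0).
rewrite mulr_suml.
transitivity (\sum_(e : {ffun 'I_m.+2 -> bool}) ((\prod_i P i (a i)^-1) *
    (\prod_(i < m.+2) \prod_(j < m.+2 | (i < j)%N) a j)) * signed_term p c (flip x e)).
  apply: eq_bigr => e _; have y0 := flip_neq0 e x0.
  rewrite (_ : \matrix_(i, j) _ = \matrix_(i, j) (phi p c (flip x e i) * entryA p a P j (flip x e i))) //.
  have := det_thetaA hp C0 a0 y0 T0 hP; rewrite -/CA => detF.
  rewrite det_scale_rows -[LHS]mulrA [X in _ * X]detF /signed_term.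
  by ring.
rewrite -mulr_sumr -/(signsum p c x) signsum_eval // (thetaV hp CA0) /CA.
by field; rewrite hden C0 A0.
Qed.

End Final.

Theorem corollary4p15 (R : realType) (p : Cplx R) (hp : 0 < `|p| < 1)
  (n : nat) (hn : (2 <= n)%N)
  (x a : 'I_n -> Cplx R) (c : 'I_(n - 2) -> Cplx R)
  (hx : forall i, x i != 0) (ha : forall i, a i != 0) (hc : forall k, c k != 0)
  (hden : theta p ((\prod_(k < n - 2) c k) * \prod_(k < n) a k) != 0)
  (P : 'I_n -> Cplx R -> Cplx R)
  (hP : forall j : 'I_n,
     A_theta p j.+1
       ((\prod_(k < n - 2) c k) * \prod_(k < n | (j < k)%N) a k)^-1 (P j)) :
  \det (\matrix_(i < n, j < n)
     (x i ^- (n - 1) * (\prod_(k < n - 2) theta p (c k * x i)) * P j (x i)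
        * (\prod_(k < n | (j < k)%N) theta p (a k * x i))
      + x i ^+ (n - 1) * (\prod_(k < n - 2) theta p (c k * (x i)^-1))
        * P j ((x i)^-1)
        * (\prod_(k < n | (j < k)%N) theta p (a k * (x i)^-1))))
  = - (4%:R * (\prod_(k < n) a k) * (\prod_(k < n - 2) c k)
         / theta p ((\prod_(k < n - 2) c k) * \prod_(k < n) a k))
    * (\prod_(i < n) P i (1 / a i))
    * (\prod_(i < n - 2) \prod_(j < n - 2 | (i <= j)%N) theta p (c i * c j))
    * (\prod_(i < n) \prod_(j < n | (i < j)%N)
         (a j * (x i)^-1 * theta_pm p (x i) (x j))).
Proof.
have := subnK hn; move: (n - 2)%N c hc hden hP => m c hc hden hP nm.
rewrite addn2 in nm; move: x a hx ha hden P hP; rewrite -nm => {n hn nm} x a hx ha hden P hP.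
have hP' (j : 'I_m.+2) : spaceA p j.+1 ((\prod_k c k) * \prod_(k < m.+2 | (j < k)%N) a k)^-1 (P j).
  by have [_ _ ? ?] := hP j.
have -> : \prod_(i < m.+2) P i (1 / a i) = \prod_i P i (a i)^-1.
  by apply: eq_bigr => i _; rewrite div1r.
have -> : \prod_(i < m.+2) \prod_(j < m.+2 | (i < j)%N) (a j * (x i)^-1 * theta_pm p (x i) (x j)) =
    (\prod_(i < m.+2) \prod_(j < m.+2 | (i < j)%N) a j) * pairprod (psiD p) x.
  rewrite -big_split /=; apply: eq_bigr => i _; rewrite -big_split /=.
  by apply: eq_bigr => j _; apply/esym/mulrA.
rewrite -(det_thetaD hp hx ha hc hden hP'); congr (\det _).
apply/matrixP => i j; rewrite !mxE /phi /entryA subn1 /= [(x i)^-1 ^+ _]exprVn invrK !mulrA.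
by [].
Qed.
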